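(* For every $n\ge1$, $[\mathrm{UVAL}_n]=[\mathrm{USAT}_n]\cap[\overline{\mathrm{USAT}}_n]$.
   Context: $\Sigma=\{0,1\}$, $\Sigma^*$ the finite nonempty binary strings; for $x\in\Sigma^m$, $\pi_1(x)=x_1$. $\mathbb{P}_+\Sigma=\{\{0\},\{1\},\Sigma\}$. A promise problem is $\phi:\Sigma^*\to\mathbb{P}_+\Sigma$. $\phi_1\propto\phi_2$ means there is a polynomial-time computable $\mu:\Sigma^*\to\Sigma^*$ with $\phi_1(x)\supseteq\phi_2(\mu(x))$ for all $x$; $[\phi]=\{\phi_1:\phi_1\propto\phi\}$. Level-$n$ problems: the input encodes (e.g. dimensions in binary plus a Boolean formula) $f:\Sigma^{m_1}\times\dots\times\Sigma^{m_n}\to\Sigma$, written $f(x,y^{(1)},\dots,y^{(n-1)})$ with $x\in\Sigma^{m_1}$; $f_x$ is $f$ with $x$ fixed. For a constant $c$, $\mathrm{SAT}_0(c)=\overline{\mathrm{SAT}}_0(c)=c$; for $n\ge1$, $\mathrm{SAT}_n(f)=1\iff\exists x:\overline{\mathrm{SAT}}_{n-1}(f_x)=1$, $\overline{\mathrm{SAT}}_n(f)=1\iff\forall x,\ \mathrm{SAT}_{n-1}(f_x)=1$; $\mathrm{USAT}_n(f)=\{\mathrm{SAT}_n(f)\}$ if $|\{x:\overline{\mathrm{SAT}}_{n-1}(f_x)=1\}|\le1$, else $\Sigma$; $\overline{\mathrm{USAT}}_n(f)=\{\overline{\mathrm{SAT}}_n(f)\}$ if $|\{x:\mathrm{SAT}_{n-1}(f_x)=0\}|\le1$,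 else $\Sigma$; $\mathrm{UVAL}_n(f)=\{\pi_1x:\overline{\mathrm{SAT}}_{n-1}(f_x)=1\}$ if there is exactly one $x$ with $\overline{\mathrm{SAT}}_{n-1}(f_x)=1$, else $\Sigma$. *)

(* Defs.v *)
From mathcomp Require Import all_boot.
Set Implicit Arguments. Unset Strict Implicit. Unset Printing Implicit Defensive.

(* Sigma^* is represented by seq bool; the empty string is excluded    *)
(* everywhere it matters (see [reducible]).                            *)

(* P_+ Sigma = {{0},{1},Sigma} *)
Inductive pset := Sing of bool | Both.

Definition pmem (S : pset) (b : bool) : bool :=
  match S with Sing c => b == c | Both => true end.

Definition psub (S T : pset) : Prop := forall b, pmem S b -> pmem T b.

Definition promise := seq bool -> pset.

Inductive dir := DL | DR | DS.

(* states 'I_(Q.+1), start state ord0; tape symbols 'I_(G.+3):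
   0 = blank, 1 = bit 0, 2 = bit 1, others auxiliary.
   delta returning None means halt. *)
Record TM := mkTM {
  tm_Q : nat;
  tm_G : nat;
  tm_delta : 'I_(tm_Q.+1) -> 'I_(tm_G.+3) ->
             option ('I_(tm_Q.+1) * 'I_(tm_G.+3) * dir) }.

Definition sym (M : TM) := 'I_((tm_G M).+3).

Record config (M : TM) := Conf {
  cst : 'I_((tm_Q M).+1);
  cleft : seq (sym M);    (* cells left of head, nearest first *)
  chead : sym M;
  cright : seq (sym M) }. (* cells right of head, nearest first *)

Definition blank (M : TM) : sym M := ord0.
Definition sym_of_bit (M : TM) (b : bool) : sym M :=
  if b then inord 2 else inord 1.

Definition step (M : TM) (c : config M) : option (config M) :=
  match tm_delta (cst c) (chead c) with
  | None => None
  | Some (q', a, d) =>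
    Some (match d with
          | DS => Conf q' (cleft c) a (cright c)
          | DL => match cleft c with
                  | [::] => Conf q' [::] (blank M) (a :: cright c)
                  | l :: ls => Conf q' ls l (a :: cright c)
                  end
          | DR => match cright c with
                  | [::] => Conf q' (a :: cleft c) (blank M) [::]
                  | r :: rs => Conf q' (a :: cleft c) r rs
                  end
          end)
  end.

Fixpoint exec (M : TM) (t : nat) (c : config M) : option (config M) :=
  match step c with
  | None => Some c
  | Some c' => match t with 0 => None | t'.+1 => exec t' c' end
  end.

Definition init (M : TM) (x : seq bool) : config M :=
  match x with
  | [::] => Conf ord0 [::] (blank M) [::]
  | b :: bs => Conf ord0 [::] (sym_of_bit M b) (map (sym_of_bit M) bs)
  end.

Fixpoint read_bits (M : TM) (s : seq (sym M)) : seq bool :=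
  match s with
  | [::] => [::]
  | a :: s' => if val a == 1 then false :: read_bits s'
               else if val a == 2 then true :: read_bits s'
               else [::]
  end.

Definition output (M : TM) (c : config M) : seq bool :=
  read_bits (chead c :: cright c).

Definition polytime (f : seq bool -> seq bool) : Prop :=
  exists (M : TM) (c k : nat), forall x : seq bool,
    exists cf : config M,
      exec (c * (size x).+1 ^ k) (init M x) = Some cf /\ output cf = f x.

Definition reducible (phi1 phi2 : promise) : Prop :=
  exists mu : seq bool -> seq bool, polytime mu /\
    forall x, x != [::] -> mu x != [::] /\ psub (phi2 (mu x)) (phi1 x).

(* Variables are indexed by position in the concatenation
   x ++ y(1) ++ ... ++ y(n-1). *)
Inductive form :=
| FVar of nat | FNot of form | FAnd of form & form | FOr of form & form.

Fixpoint feval (f : form) (a : seq bool) : bool :=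
  match f with
  | FVar i => nth false a i
  | FNot g => ~~ feval g a
  | FAnd g h => feval g a && feval h a
  | FOr g h => feval g a || feval h a
  end.

Fixpoint fwf (k : nat) (f : form) : bool :=
  match f with
  | FVar i => i < k
  | FNot g => fwf k g
  | FAnd g h => fwf k g && fwf k h
  | FOr g h => fwf k g && fwf k h
  end.

(* self-delimiting binary numbers (msb first): 00 -> 0, 11 -> 1, 01 -> end *)
Fixpoint dnat (acc : nat) (s : seq bool) : option (nat * seq bool) :=
  match s with
  | false :: false :: s' => dnat acc.*2 s'
  | true :: true :: s' => dnat acc.*2.+1 s'
  | false :: true :: s' => Some (acc, s')
  | _ => None
  end.

Fixpoint dform (fuel : nat) (s : seq bool) : option (form * seq bool) :=
  match fuel with
  | 0 => None
  | fuel'.+1 =>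
    match s with
    | false :: false :: s' =>
        match dnat 0 s' with Some (i, r) => Some (FVar i, r) | None => None end
    | false :: true :: s' =>
        match dform fuel' s' with Some (g, r) => Some (FNot g, r) | None => None end
    | true :: false :: s' =>
        match dform fuel' s' with
        | Some (g, r) => match dform fuel' r with
                         | Some (h, r') => Some (FAnd g h, r') | None => None end
        | None => None end
    | true :: true :: s' =>
        match dform fuel' s' with
        | Some (g, r) => match dform fuel' r with
                         | Some (h, r') => Some (FOr g h, r') | None => None end
        | None => None end
    | _ => None
    end
  end.

Fixpoint ddims (n : nat) (s : seq bool) : option (seq nat * seq bool) :=
  match n with
  | 0 => Some ([::], s)
  | n'.+1 =>
    match dnat 0 s with
    | Some (m, r) => match ddims n' r with
                     | Some (ms, r') => Some (m :: ms, r') | None => None end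
    | None => None
    end
  end.

Definition decode (n : nat) (x : seq bool) : option (seq nat * form) :=
  match ddims n x with
  | Some (ms, r) =>
    match dform (size r) r with
    | Some (f, [::]) =>
        if all (fun m => 0 < m) ms && fwf (sumn ms) f then Some (ms, f) else None
    | _ => None
    end
  | None => None
  end.

(* SAT_k / coSAT_k of f with a prefix of the variables already fixed.  *)
(* qsat true = SAT, qsat false = coSAT.                                *)
Fixpoint qsat (e : bool) (ms : seq nat) (pre : seq bool) (f : form) : bool :=
  match ms with
  | [::] => feval f pre
  | m :: ms' =>
    if e then [exists y : m.-tuple bool, qsat false ms' (pre ++ val y) f]
    else [forall y : m.-tuple bool, qsat true ms' (pre ++ val y) f]
  end.

(* Invalid encodings carry no promise (value Sigma). *)
Definition USAT (n : nat) : promise := fun x =>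
  match decode n x with
  | Some (m1 :: rest, f) =>
      if #|[set y : m1.-tuple bool | qsat false rest (val y) f]| <= 1
      then Sing (qsat true (m1 :: rest) [::] f) else Both
  | _ => Both
  end.

Definition coUSAT (n : nat) : promise := fun x =>
  match decode n x with
  | Some (m1 :: rest, f) =>
      if #|[set y : m1.-tuple bool | ~~ qsat true rest (val y) f]| <= 1
      then Sing (qsat false (m1 :: rest) [::] f) else Both
  | _ => Both
  end.

Definition UVAL (n : nat) : promise := fun x =>
  match decode n x with
  | Some (m1 :: rest, f) =>
      let S := [set y : m1.-tuple bool | qsat false rest (val y) f] in
      if #|S| == 1 then
        match [pick y in S] with
        | Some y => Sing (head false (val y))
        | None => Both
        end
      else Both
  | _ => Both
  end.

(* Main.v *)
(* A deterministic polynomial-time reduction can be run on a Turing machine or, equivalently,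
   by a program on finitely many stacks of bits; the latter class is easily seen to be closed
   under pairing, case analysis and polynomially bounded folds, and this is where the
   reductions below are programmed.

   If f has a unique x with coSAT(f_x) = 1, then x_1 /\ f has a solution iff x_1 = 1, and
   x_1 \/ ~f is always satisfied iff x_1 = 1; each has at most one exceptional x, which reduces
   UVAL to USAT and to coUSAT. Conversely, let f and g be the USAT and coUSAT instances produced
   from the same word. Then h(b, z, w) = (b /\ w = 0 /\ f(z)) \/ (~b /\ z = 0 /\ ~g(w)), with the
   inner blocks of f and g concatenated, has exactly one solution and its first bit b is the
   common answer. The equations w = 0 and z = 0 are written out literally, which takes
   polynomial space only if the first blocks are not longer than the formulas; if the first block
   of f is longer than f, some variable of it does not occur in f, so f cannot have exactly one
   solution and the answer 0 is safe, and symmetrically for g. *)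
Require Import Defs.
From mathcomp Require Import all_boot.
From mathcomp Require Import zify.
From Stdlib Require Import FunctionalExtensionality.
Set Implicit Arguments. Unset Strict Implicit. Unset Printing Implicit Defensive.

(** A reduction is given only as a Turing machine, whereas the new reductions are written as
    programs. Both directions between machines and programs are therefore needed: a given [mu] is
    brought to the program side by simulating its machine along a unary clock, composed there, and
    the result is compiled back. In the merged formula h the inner blocks of f and g can be
    concatenated at the same quantifier level because b is fixed in the outermost block: from then
    on one formula is dead and its parts of the inner blocks are dummies. Negating g exchanges its
    quantifiers, coSAT(~g_w) = ~SAT(g_w), so the exceptional w of g become solutions. The equations
    w = 0 and z = 0 pin down the outer block of the dead formula, which would otherwise multiply the
    solution. Dimensions are written in binary, so a block may be exponentially longer than the word
    that describes it. Variables are therefore renumbered by arithmetic on numerals, never by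
    running through a block. *)

Definition upd A (s : nat -> A) (r : nat) (v : A) : nat -> A :=
  fun i => if i == r then v else s i.

Lemma upd_id A (s : nat -> A) r : upd s r (s r) = s.
Proof. by apply: functional_extensionality => i; rewrite /upd; case: eqP => // ->. Qed.

(** * A stack language *)

Definition store := nat -> seq bool.

Inductive cmd :=
| Skip
| Push of nat & bool
| PopC of nat & cmd & cmd & cmd
| Seq of cmd & cmd
| While of nat & cmd.

Inductive ev : cmd -> store -> nat -> store -> Prop :=
| ev_skip s : ev Skip s 1 s
| ev_push s r b : ev (Push r b) s 1 (upd s r (b :: s r))
| ev_pop0 s r p0 p1 p2 t s' : s r = [::] -> ev p0 s t s' ->
    ev (PopC r p0 p1 p2) s t.+1 s'
| ev_pop1 s r p0 p1 p2 t s' l : s r = false :: l -> ev p1 (upd s r l) t s' ->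
    ev (PopC r p0 p1 p2) s t.+1 s'
| ev_pop2 s r p0 p1 p2 t s' l : s r = true :: l -> ev p2 (upd s r l) t s' ->
    ev (PopC r p0 p1 p2) s t.+1 s'
| ev_seq s1 s2 s3 p q t1 t2 : ev p s1 t1 s2 -> ev q s2 t2 s3 ->
    ev (Seq p q) s1 (t1 + t2).+1 s3
| ev_while0 s r p : s r = [::] -> ev (While r p) s 1 s
| ev_while s1 s2 s3 r p t1 t2 : s1 r != [::] -> ev p s1 t1 s2 ->
    ev (While r p) s2 t2 s3 -> ev (While r p) s1 (t1 + t2).+1 s3.

(** A unit of time pushes at most one bit. Running time thus bounds stack height, and with it the
    distance the head of the compiled machine has to walk. *)
Lemma ev_size p s t s' : ev p s t s' -> forall r, size (s' r) <= size (s r) + t.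
Proof.
elim=> {p s t s'}.
- by move=> s r; lia.
- by move=> s r b i; rewrite /upd; case: eqP => [->|_] /=; lia.
- by move=> s r p0 p1 p2 t s' _ _ IH i; move: (IH i); lia.
- move=> s r p0 p1 p2 t s' l E _ IH i; move: (IH i); rewrite /upd.
  by case: eqP => [->|_]; rewrite ?E /=; lia.
- move=> s r p0 p1 p2 t s' l E _ IH i; move: (IH i); rewrite /upd.
  by case: eqP => [->|_]; rewrite ?E /=; lia.
- by move=> s1 s2 s3 p q t1 t2 _ H1 _ H2 r; move: (H1 r) (H2 r); lia.
- by move=> s r p _ i; lia.
- by move=> s1 s2 s3 r p t1 t2 _ _ H1 _ H2 i; move: (H1 i) (H2 i); lia.
Qed.

(** A program mentions finitely many registers; a bound on their numbers fixes the number of tracks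
    on the compiled tape. *)
Fixpoint regs_le (k : nat) (p : cmd) : bool :=
  match p with
  | Skip => true
  | Push r _ => r <= k
  | PopC r p0 p1 p2 => [&& r <= k, regs_le k p0, regs_le k p1 & regs_le k p2]
  | Seq p q => regs_le k p && regs_le k q
  | While r p => (r <= k) && regs_le k p
  end.

Lemma regs_leW k k' p : k <= k' -> regs_le k p -> regs_le k' p.
Proof.
move=> kk'; elim: p => //=.
- by move=> r _ H; lia.
- by move=> r p0 IH0 p1 IH1 p2 IH2 /and4P[H /IH0 -> /IH1 -> /IH2 ->]; rewrite !andbT; lia.
- by move=> p IH q IHq /andP[/IH -> /IHq ->].
- by move=> r p IH /andP[H /IH ->]; rewrite andbT; lia.
Qed.

Lemma regs_le_ex p : exists k, regs_le k p.
Proof.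
elim: p => [|r b|r p0 [k0 H0] p1 [k1 H1] p2 [k2 H2]|p [k H] q [k' H']|r p [k H]].
- by exists 0.
- by exists r => /=.
- exists (r + k0 + k1 + k2) => /=; apply/and4P; split; first by lia.
  + by apply: regs_leW H0; lia.
  + by apply: regs_leW H1; lia.
  + by apply: regs_leW H2; lia.
- exists (k + k') => /=; apply/andP; split.
  + by apply: regs_leW H; lia.
  + by apply: regs_leW H'; lia.
- exists (r + k) => /=; apply/andP; split; first by lia.
  by apply: regs_leW H; lia.
Qed.

(** * Machines over an arbitrary finite alphabet *)

Record mach (S : Type) := Mach {
  mst : finType;
  mstart : mst;
  mdl : mst -> S -> option (mst * S * dir) }.

(** The tape is a half-line. A left move from cell 0 has no successor, whereas [step] would create a
    blank there; the runs of [arun] therefore never leave the half-line. *)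
Definition astep S (m : mach S) (c : mst m * nat * (nat -> S)) :=
  let: (q, p, T) := c in
  match mdl q (T p) with
  | None => None
  | Some (q', a, DS) => Some (q', p, upd T p a)
  | Some (q', a, DR) => Some (q', p.+1, upd T p a)
  | Some (q', a, DL) => if p is p'.+1 then Some (q', p', upd T p a) else None
  end.

Inductive arun S (m : mach S) : nat -> mst m * nat * (nat -> S) ->
    mst m * nat * (nat -> S) -> Prop :=
| arun0 c : arun 0 c c
| arunS t c c1 c2 : astep c = Some c1 -> arun t c1 c2 -> arun t.+1 c c2.

Lemma arun_cat S (m : mach S) t1 t2 (c1 c2 c3 : mst m * nat * (nat -> S)) :
  arun t1 c1 c2 -> arun t2 c2 c3 -> arun (t1 + t2) c1 c3.
Proof.
elim=> {t1 c1 c2} // t c c1 c2 E _ IH H.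
by rewrite addSn; apply: arunS E (IH H).
Qed.

Lemma arun1 S (m : mach S) (c c' : mst m * nat * (nat -> S)) :
  astep c = Some c' -> arun 1 c c'.
Proof. by move=> E; apply: arunS E (arun0 _). Qed.

(** Only defined transitions have to be preserved: where the component halts, the enclosing machine
    is free to continue differently. *)
Lemma arun_embed S (m M : mach S) (h : mst m -> mst M) :
  (forall q a q' a' d, mdl q a = Some (q', a', d) -> mdl (h q) a = Some (h q', a', d)) ->
  forall t c c', arun t c c' -> arun t (h c.1.1, c.1.2, c.2) (h c'.1.1, c'.1.2, c'.2).
Proof.
move=> H t c c'; elim=> {t c c'}; first by move=> c; exact: arun0.
move=> t [[q p] T] c1 c2 E _ IH; apply: arunS _ IH => /=.
move: E => /=; case E: (mdl q (T p)) => [[[q' a] d]|//].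
rewrite (H _ _ _ _ _ E); case: d E => _.
- by case: p => [//|p [<-]].
- by case=> <-.
- by case=> <-.
Qed.

Lemma arun_right S (m : mach S) (q : mst m) (T : nat -> S) n :
  (forall i, i < n -> mdl q (T i) = Some (q, T i, DR)) -> arun n (q, 0, T) (q, n, T).
Proof.
elim: n => [|n IH] H; first exact: arun0.
rewrite -addn1; apply: arun_cat (IH _) _; first by move=> i Hi; apply: H; lia.
apply: arun1 => /=; rewrite H; last by [].
by rewrite upd_id addn1.
Qed.

Lemma arun_left S (m : mach S) (q : mst m) (T : nat -> S) n :
  (forall i, 0 < i <= n -> mdl q (T i) = Some (q, T i, DL)) -> arun n (q, n, T) (q, 0, T).
Proof.
elim: n => [|n IH] H; first exact: arun0.
apply: (@arunS _ _ _ _ (q, n, T)); last by apply: IH => i Hi; apply: H; lia.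
by rewrite /= H ?upd_id //; lia.
Qed.

(** * Compilation of the stack language *)

(* Track [r] of the tape holds register [r], bottom of the stack at cell 0, which
   carries a mark; the head rests on cell 0 between two commands. *)
Definition cell (k : nat) : finType := (bool * {ffun 'I_k.+1 -> option bool})%type.

Definition track k (a : cell k) (r : nat) : option bool := a.2 (inord r).
Definition setc k (a : cell k) (r : nat) (v : option bool) : cell k :=
  (a.1, [ffun j : 'I_k.+1 => if j == r :> nat then v else a.2 j]).

Definition tape k (s : store) : nat -> cell k :=
  fun i => (i == 0, [ffun j : 'I_k.+1 => onth (rev (s j)) i]).

Lemma track_tape k s i r : r <= k -> track (tape k s i) r = onth (rev (s r)) i.
Proof. by move=> rk; rewrite /track ffunE inordK. Qed.

Lemma track_home k s r : r <= k -> (track (tape k s 0) r == None) = (s r == [::]).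
Proof.
move=> rk; rewrite track_tape //; case: (s r) => [//|b l].
by rewrite rev_cons; case: (rev l).
Qed.

Lemma onth_isSome (T : Type) (l : seq T) i : isSome (onth l i) = (i < size l).
Proof. by elim: l i => [|a l IH] [|i] //=. Qed.

Lemma tape_push k s r b : r <= k ->
  upd (tape k s) (size (s r)) (setc (tape k s (size (s r))) r (Some b))
  = tape k (upd s r (b :: s r)).
Proof.
move=> rk; apply: functional_extensionality => i; rewrite /upd.
case: eqP => [->|Ni]; congr (_, _); apply/ffunP => j; rewrite !ffunE.
- case: ifP => // _.
  by rewrite rev_cons onthE map_rcons nth_rcons size_map size_rev ltnn eqxx.
- case: ifP => [/eqP ->|_] //.
  rewrite rev_cons !onthE map_rcons nth_rcons size_map size_rev.
  case: ltnP => // Hi; case: eqP => // _.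
  by rewrite nth_default // size_map size_rev.
Qed.

Lemma tape_pop k s r b l : r <= k -> s r = b :: l ->
  upd (tape k s) (size l) (setc (tape k s (size l)) r None) = tape k (upd s r l).
Proof.
move=> rk E; apply: functional_extensionality => i; rewrite /upd.
case: eqP => [->|Ni]; congr (_, _); apply/ffunP => j; rewrite !ffunE.
- case: ifP => // _.
  by rewrite onthE nth_default // size_map size_rev.
- case: ifP => [/eqP ->|_] //.
  rewrite E rev_cons !onthE map_rcons nth_rcons size_map size_rev.
  case: ltnP => // Hi; case: eqP => // _.
  by rewrite nth_default // size_map size_rev.
Qed.

Definition skip_mach k : mach (cell k) := @Mach _ unit tt (fun _ _ => None).

(** In state [false] the head looks to the right for the first free cell of the track; in state
    [true] it returns to the marked cell and halts there. *)
Definition push_mach k (r : nat) (b : bool) : mach (cell k) :=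
  @Mach _ bool false (fun q a =>
    if q then (if a.1 then None else Some (true, a, DL))
    else if track a r is Some _ then Some (false, a, DR)
    else Some (true, setc a r (Some b), DS)).

(** The default is what the enclosing machine does at the point where the component halts. *)
Definition lift_dl (Q1 Q2 : Type) S (h : Q1 -> Q2) (x : option (Q1 * S * dir)) (dflt : option (Q2 * S * dir)) :=
  if x is Some (q, a, d) then Some (h q, a, d) else dflt.

Definition seq_mach S (m1 m2 : mach S) : mach S :=
  @Mach _ (mst m1 + mst m2)%type (inl (mstart m1)) (fun q a =>
    match q with
    | inl q1 => lift_dl inl (mdl q1 a) (Some (inr (mstart m2), a, DS))
    | inr q2 => lift_dl inr (mdl q2 a) None
    end).

Definition while_mach k (r : nat) (m : mach (cell k)) : mach (cell k) :=
  @Mach _ (option (mst m)) None (fun q a =>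
    match q with
    | None => if track a r is Some _ then Some (Some (mstart m), a, DS) else None
    | Some q1 => lift_dl Some (mdl q1 a) (Some (None, a, DS))
    end).

(* Control states of a pop: scanning right, removing the top, and returning home with the popped bit. *)
Definition pop_mach k (r : nat) (m0 m1 m2 : mach (cell k)) : mach (cell k) :=
  @Mach _ (option (option bool) + (mst m0 + (mst m1 + mst m2)))%type (inl None) (fun q a =>
    match q with
    | inl None =>
        if track a r is Some _ then Some (inl None, a, DR)
        else if a.1 then Some (inr (inl (mstart m0)), a, DS)
        else Some (inl (Some None), a, DL)
    | inl (Some None) =>
        if track a r is Some b then Some (inl (Some (Some b)), setc a r None, DS) else None
    | inl (Some (Some b)) =>
        if a.1 then
          Some (inr (inr (if b then inr (mstart m2) else inl (mstart m1))), a, DS)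
        else Some (inl (Some (Some b)), a, DL)
    | inr (inl q0) => lift_dl (fun x => inr (inl x)) (mdl q0 a) None
    | inr (inr (inl q1)) => lift_dl (fun x => inr (inr (inl x))) (mdl q1 a) None
    | inr (inr (inr q2)) => lift_dl (fun x => inr (inr (inr x))) (mdl q2 a) None
    end).

Fixpoint compile (k : nat) (p : cmd) : mach (cell k) :=
  match p with
  | Skip => skip_mach k
  | Push r b => push_mach k r b
  | PopC r p0 p1 p2 => pop_mach r (compile k p0) (compile k p1) (compile k p2)
  | Seq p q => seq_mach (compile k p) (compile k q)
  | While r p => while_mach r (compile k p)
  end.

Lemma push_run k r b s : r <= k ->
  arun (m := push_mach k r b) (size (s r) + (size (s r)).+1) (false, 0, tape k s)
    (true, 0, tape k (upd s r (b :: s r))).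
Proof.
move=> rk; apply: arun_cat.
  apply: (arun_right (m := push_mach k r b)) => i Hi /=.
  rewrite track_tape //.
  by move: (onth_isSome (rev (s r)) i); rewrite size_rev Hi; case: onth.
apply: (@arunS _ (push_mach k r b) _ _ (true, size (s r), tape k (upd s r (b :: s r)))).
  rewrite /= track_tape // onthE nth_default ?size_map ?size_rev //.
  by rewrite tape_push.
by apply: (arun_left (m := push_mach k r b)) => i /andP[i0 _] /=; rewrite gtn_eqF.
Qed.

Lemma pop_run k r m0 m1 m2 s b l : r <= k -> s r = b :: l ->
  arun (m := pop_mach (k := k) r m0 m1 m2) ((size l).+1 + (2 + (size l).+1))
    (inl None, 0, tape k s)
    (inr (inr (if b then inr (mstart m2) else inl (mstart m1))), 0, tape k (upd s r l)).
Proof.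
move=> rk E; apply: arun_cat.
  apply: (arun_right (m := pop_mach r m0 m1 m2)) => i Hi /=.
  rewrite track_tape //.
  by move: (onth_isSome (rev (s r)) i); rewrite size_rev E Hi; case: onth.
apply: (@arun_cat _ (pop_mach r m0 m1 m2) _ _ _ (inl (Some (Some b)), size l, tape k (upd s r l))).
  apply: (@arunS _ (pop_mach r m0 m1 m2) _ _ (inl (Some None), size l, tape k s)).
    rewrite /= track_tape // onthE nth_default ?size_map ?size_rev ?E //.
    by rewrite upd_id.
  apply: arun1; rewrite /= track_tape // E rev_cons onthE map_rcons nth_rcons.
  by rewrite size_map size_rev ltnn eqxx (tape_pop _ E).
rewrite -addn1; apply: arun_cat.
  by apply: (arun_left (m := pop_mach r m0 m1 m2)) => i /andP[i0 _] /=; rewrite gtn_eqF.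
by apply: arun1; rewrite /= upd_id.
Qed.

(** A command costs at most one walk to the top of a stack and back. Stack height during the whole
    run is at most initial height plus running time, so a single [B] can be fixed in advance. *)
Lemma compileP k p s t s' B : ev p s t s' -> regs_le k p ->
  (forall r, size (s r) + t <= B) ->
  exists q t', [/\ t' <= t * (2 * B + 5),
    arun (m := compile k p) t' (mstart _, 0, tape k s) (q, 0, tape k s') &
    mdl q (tape k s' 0) = None].
Proof.
move=> H; elim: H => {p s t s'} /=.
- by move=> s _ _; exists tt, 0; split => //; exact: arun0.
- move=> s r b rk HB; exists true, (size (s r) + (size (s r)).+1); split => //.
  + by move: (HB r); lia.
  + exact: push_run.
- move=> s r p0 p1 p2 t s' E _ IH /and4P[rk H0 _ _] HB.
  have [|q [t' [Ht R Hq]]] := IH H0; first by move=> i; move: (HB i); lia.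
  exists (inr (inl q)), t'.+1; split; first by lia.
  + apply: (@arunS _ (pop_mach r _ _ _) _ _ (inr (inl (mstart (compile k p0))), 0, tape k s)).
      move/eqP: E; rewrite -(track_home _ rk) /= => /eqP ->.
      by rewrite upd_id.
    apply: (arun_embed (m := compile k p0) (M := pop_mach r _ _ _) (h := fun x => inr (inl x))) R.
    by move=> q1 a q' a' d /= ->.
  + by rewrite /= Hq.
- move=> s r p0 p1 p2 t s' l E _ IH /and4P[rk _ H1 _] HB.
  have [|q [t' [Ht R Hq]]] := IH H1.
    by move=> i; rewrite /upd; case: eqP => [_|]; move: (HB i) (HB r); rewrite ?E /=; lia.
  exists (inr (inr (inl q))), ((size l).+1 + (2 + (size l).+1) + t'); split.
  + by move: (HB r); rewrite E /=; lia.
  + apply: arun_cat; first exact: pop_run E.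
    apply: (arun_embed (m := compile k p1) (M := pop_mach r _ _ _) (h := fun x => inr (inr (inl x)))) R.
    by move=> q1 a q' a' d /= ->.
  + by rewrite /= Hq.
- move=> s r p0 p1 p2 t s' l E _ IH /and4P[rk _ _ H1] HB.
  have [|q [t' [Ht R Hq]]] := IH H1.
    by move=> i; rewrite /upd; case: eqP => [_|]; move: (HB i) (HB r); rewrite ?E /=; lia.
  exists (inr (inr (inr q))), ((size l).+1 + (2 + (size l).+1) + t'); split.
  + by move: (HB r); rewrite E /=; lia.
  + apply: arun_cat; first exact: pop_run E.
    apply: (arun_embed (m := compile k p2) (M := pop_mach r _ _ _) (h := fun x => inr (inr (inr x)))) R.
    by move=> q1 a q' a' d /= ->.
  + by rewrite /= Hq.
- move=> s1 s2 s3 p q t1 t2 E1 IH1 _ IH2 /andP[Hp Hq] HB.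
  have [|q1 [t1' [Ht1 R1 H1]]] := IH1 Hp; first by move=> r; move: (HB r); lia.
  have [|q2 [t2' [Ht2 R2 H2]]] := IH2 Hq.
    by move=> r; move: (HB r) (ev_size E1 r); lia.
  exists (inr q2), (t1' + (1 + t2')); split; first by lia.
  + apply: arun_cat.
      apply: (arun_embed (m := compile k p) (M := seq_mach _ (compile k q)) (h := inl)) R1.
      by move=> x a q' a' d /= ->.
    apply: (@arun_cat _ (seq_mach _ _) _ _ _ (inr (mstart (compile k q)), 0, tape k s2)).
      by apply: arun1; rewrite /= H1 /= upd_id.
    apply: (arun_embed (m := compile k q) (M := seq_mach (compile k p) _) (h := inr)) R2.
    by move=> x a q' a' d /= ->.
  + by rewrite /= H2.
- move=> s r p E /andP[rk _] _; exists None, 0; split => //; first exact: arun0.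
  by move/eqP: E; rewrite -(track_home _ rk) /= => /eqP ->.
- move=> s1 s2 s3 r p t1 t2 E E1 IH1 _ IH2 /[dup] Hall /andP[rk Hp] HB.
  have [|q1 [t1' [Ht1 R1 H1]]] := IH1 Hp; first by move=> i; move: (HB i); lia.
  have [|q2 [t2' [Ht2 R2 H2]]] := IH2 Hall.
    by move=> i; move: (HB i) (ev_size E1 i); lia.
  exists q2, (1 + (t1' + (1 + t2'))); split; [by lia| |exact: H2].
  apply: (@arun_cat _ (while_mach r _) _ _ _ (Some (mstart (compile k p)), 0, tape k s1)).
    apply: arun1; move: E; rewrite -(track_home _ rk) /=.
    by case: track => [b _|//]; rewrite upd_id.
  apply: arun_cat.
    apply: (arun_embed (m := compile k p) (M := while_mach r _) (h := Some)) R1.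
    by move=> x a q' a' d /= ->.
  apply: arun_cat R2.
  by apply: arun1; rewrite /= H1 /= upd_id.
Qed.

(** * From abstract machines to Turing machines *)

Section ToTM.
Variables (S : finType) (m : mach S) (b0 b1 b2 : S).
Hypotheses (b01 : b1 != b0) (b02 : b2 != b0) (b12 : b2 != b1).

(** A [TM] starts in state 0, so the start state has code 0 and every other state its rank plus
    one. *)
Definition qcode (q : mst m) : 'I_(#|mst m|.+1) :=
  if q == mstart m then ord0 else inord (enum_rank q).+1.
Definition qdec (i : 'I_(#|mst m|.+1)) : mst m :=
  if val i is j.+1 then nth (mstart m) (enum (mst m)) j else mstart m.

Lemma qcodeK q : qdec (qcode q) = q.
Proof.
rewrite /qcode; case: eqP => [->|_] //.
rewrite /qdec /= inordK ?ltnS ?ltn_ord // -[in RHS](enum_rankK q).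
by rewrite [RHS](enum_val_nth (mstart m)).
Qed.

(** The input convention of [TM] prescribes the first three symbols: blank, bit 0, bit 1. All others
    are moved beyond them. *)
Definition scode (a : S) : 'I_(#|S|.+3) :=
  if a == b0 then ord0 else if a == b1 then inord 1 else if a == b2 then inord 2
  else inord (enum_rank a).+3.
Definition sdec (i : 'I_(#|S|.+3)) : S :=
  match val i with 0 => b0 | 1 => b1 | 2 => b2 | j.+3 => nth b0 (enum S) j end.

Lemma scodeK a : sdec (scode a) = a.
Proof.
rewrite /scode; case: eqP => [->|_] //; case: eqP => [->|_].
  by rewrite /sdec /= inordK.
case: eqP => [->|_]; first by rewrite /sdec /= inordK.
rewrite /sdec /= inordK ?ltnS ?ltn_ord // -[in RHS](enum_rankK a).
by rewrite [RHS](enum_val_nth b0).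
Qed.

Definition toTM : TM := @mkTM #|mst m| #|S| (fun i j =>
  lift_dl qcode (omap (fun x => (x.1.1, scode x.1.2, x.2)) (mdl (qdec i) (sdec j))) None).

(** The length of the left list is the head position, so the leftmost listed cell is always cell 0.
    Cells beyond the right list read as blank, hence the lists need no normal form. *)
Definition sim (c : mst m * nat * (nat -> S)) (d : config toTM) : Prop :=
  [/\ cst d = qcode c.1.1, size (cleft d) = c.1.2 &
      forall i, nth (blank toTM) (rev (cleft d) ++ chead d :: cright d) i = scode (c.2 i)].

Lemma sim_head q p T d : sim (q, p, T) d -> chead d = scode (T p).
Proof. by case=> _ /= <- <-; rewrite nth_cat size_rev ltnn subnn. Qed.

Lemma sim_upd q p T d a i : sim (q, p, T) d ->
  nth (blank toTM) (rev (cleft d) ++ scode a :: cright d) i = scode (upd T p a i).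
Proof.
case=> _ /= <- H; move: (H i); rewrite /upd !nth_cat size_rev.
case: ltngtP => [//|Hi|->]; last by rewrite subnn.
by rewrite -(subnSK Hi).
Qed.

Lemma sim_step c c' d : sim c d -> astep c = Some c' ->
  exists2 d', step d = Some d' & sim c' d'.
Proof.
case: c => [[q p] T] Hs /=.
case E: (mdl q (T p)) => [[[q' a] dd]|//].
have Hh := sim_head Hs; have Hu := sim_upd a _ Hs.
have -> : step d = Some (match dd with
          | DS => @Conf toTM (qcode q') (cleft d) (scode a) (cright d)
          | DL => match cleft d with
                  | [::] => @Conf toTM (qcode q') [::] (blank toTM) (scode a :: cright d)
                  | l :: ls => @Conf toTM (qcode q') ls l (scode a :: cright d)
                  end
          | DR => match cright d with
                  | [::] => @Conf toTM (qcode q') (scode a :: cleft d) (blank toTM) [::]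
                  | r :: rs => @Conf toTM (qcode q') (scode a :: cleft d) r rs
                  end
          end).
  by rewrite /step; case: (Hs) => -> _ _; rewrite Hh /= qcodeK scodeK E.
case: Hs => Hq Hp _; rewrite /= in Hp; clear Hh Hq.
case: dd E => _.
- case: p Hp Hu => [//|p] Hp Hu [<-]; case: (cleft d) Hp Hu => [//|l ls] [Hp] Hu.
  eexists; first by []; split=> //= i; rewrite -Hu.
  by rewrite rev_cons cat_rcons.
- move=> [<-]; case: (cright d) Hu => [|r rs] Hu; (eexists; first by []); split=> //=;
    rewrite ?Hp // => i; rewrite -Hu rev_cons cat_rcons //.
  rewrite !nth_cat; case: ltnP => // Hi.
  case: (i - _) => [|[|j]] //=; by rewrite nth_nil.
- by move=> [<-]; eexists; first by [].
Qed.

Lemma sim_exec t c c' d n : arun t c c' -> mdl c'.1.1 (c'.2 c'.1.2) = None -> t <= n ->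
  sim c d -> exists2 d', exec n d = Some d' & sim c' d'.
Proof.
move=> R; elim: R d n => {t c c'}.
  move=> [[q p] T] d n /= Hn _ Hs; exists d => //.
  have -> // : forall n, exec n d = match step d with None => Some d | Some c' =>
    match n with 0 => None | t'.+1 => exec t' c' end end by case.
  have -> // : step d = None.
  by rewrite /step (sim_head Hs); case: Hs => -> _ _ /=; rewrite qcodeK scodeK Hn.
move=> t c c1 c2 E _ IH d [//|n] Hn Ht Hs.
have [d' Hd Hs'] := sim_step Hs E.
by have [d2 H2 H3] := IH d' n Hn Ht Hs'; exists d2 => //=; rewrite Hd.
Qed.

Definition raw_tape (x : seq bool) : nat -> S :=
  fun i => if onth x i is Some b then (if b then b2 else b1) else b0.

Lemma scode_bit b : scode (if b then b2 else b1) = sym_of_bit toTM b.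
Proof.
rewrite /scode /sym_of_bit; case: b; rewrite ?(negPf b02) ?(negPf b01) ?(negPf b12) eqxx //.
Qed.

Lemma sim_init x : sim (mstart m, 0, raw_tape x) (init toTM x).
Proof.
have E : scode b0 = blank toTM by rewrite /scode eqxx.
case: x => [|b x]; split => //=; rewrite /qcode ?eqxx //.
- by case=> [|i]; rewrite /raw_tape /= ?nth_nil.
  move=> i; rewrite -map_cons.
elim: (b :: x) i => [|c y IH] [|i] //=; rewrite ?nth_nil /raw_tape /= ?E ?scode_bit //.
Qed.

Lemma sim_output q x d : sim (q, 0, raw_tape x) d -> output d = x.
Proof.
case=> _ /= /size0nil -> /=; rewrite /output; move: (chead d :: cright d) => l {d}.
have E : scode b0 = blank toTM by rewrite /scode eqxx.
elim: x l => [|b x IH] [|a l] //= H.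
- by move: (H 0) => /= ->; rewrite /raw_tape /= E.
- move: (H 0); rewrite /raw_tape /= scode_bit => /(congr1 val).
  by case: (b); rewrite /= inordK.
- move: (H 0); rewrite /raw_tape /= scode_bit => ->.
  have -> : read_bits l = x by apply: IH => i; apply: (H i.+1).
  by case: (b) => /=; rewrite inordK.
Qed.

End ToTM.

Definition store0 (x : seq bool) : store := fun r => if r == 0 then x else [::].

(** A raw input carries no home mark. The first step sets it and the last one erases it, so that
    cell 0 of the output is again a plain bit or blank. *)
Definition unmarked_mach k (m : mach (cell k)) : mach (cell k) :=
  @Mach _ (option (mst m) + unit)%type (inl None) (fun q a =>
    match q with
    | inl None => Some (inl (Some (mstart m)), (true, a.2), DS)
    | inl (Some q1) => lift_dl (fun x => inl (Some x)) (mdl q1 a) (Some (inr tt, (false, a.2), DS))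
    | inr _ => None
    end).

(** Unmarked cells with nothing outside track 0; these serve as blank and bits of the Turing
    machine. *)
Definition raw_cell k (o : option bool) : cell k :=
  (false, [ffun j : 'I_k.+1 => if j == 0 :> nat then o else None]).

Lemma raw_cell_inj k : injective (@raw_cell k).
Proof. by move=> o o' [/ffunP/(_ ord0)]; rewrite !ffunE. Qed.

Lemma tape_store0 k x i : tape k (store0 (rev x)) i = (i == 0, (raw_cell k (onth x i)).2).
Proof.
congr (_, _); apply/ffunP => j; rewrite !ffunE /store0.
case: eqP => _; first by rewrite revK.
by case: i.
Qed.

Lemma raw_tapeE k x i :
  raw_tape (raw_cell k None) (raw_cell k (Some false)) (raw_cell k (Some true)) x i
  = raw_cell k (onth x i).
Proof. by rewrite /raw_tape; case: onth => [[]|]. Qed.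

(* Register 0 holds the reversed word since a stack grows to the right on the tape. *)
Lemma polytime_of_cmd (f : seq bool -> seq bool) p c e :
  (forall x, exists2 t, t <= c * (size x).+1 ^ e & ev p (store0 (rev x)) t (store0 (rev (f x)))) ->
  polytime f.
Proof.
move=> H; have [k Hk] := regs_le_ex p.
pose M := unmarked_mach (compile k p).
set B0 := raw_cell k None; set B1 := raw_cell k (Some false); set B2 := raw_cell k (Some true).
have b01 : B1 != B0 by apply/eqP => /raw_cell_inj.
have b02 : B2 != B0 by apply/eqP => /raw_cell_inj.
have b12 : B2 != B1 by apply/eqP => /raw_cell_inj.
(* With N = (|x|+1)^e the compiled program takes at most cN(2(|x|+cN)+5) <= c(2c+7) N^2 (|x|+1)
   steps; the summand 2 pays for setting and erasing the mark. *)
exists (toTM M B0 B1 B2), (2 + c * (2 * c + 7)), (2 * e + 1) => x.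
have [t Ht E] := H x.
have [|q [t' [Ht' R Hq]]] := compileP (B := size x + t) E Hk.
  by move=> r; rewrite /store0; case: eqP; rewrite ?size_rev /=; lia.
have R' : arun (m := M) (1 + (t' + 1)) (mstart M, 0, raw_tape B0 B1 B2 x)
    (inr tt, 0, raw_tape B0 B1 B2 (f x)).
  apply: (@arun_cat _ M _ _ _ (inl (Some (mstart (compile k p))), 0, tape k (store0 (rev x)))).
    apply: arun1; rewrite /=; congr (Some (_, _, _)).
    apply: functional_extensionality => i; rewrite tape_store0 /upd !raw_tapeE.
    by case: eqP => [->|_].
  apply: arun_cat.
    apply: (arun_embed (m := compile k p) (M := M) (h := fun z => inl (Some z))) R.
    by move=> z a q' a' d /= ->.
  apply: arun1; rewrite /= Hq /=; congr (Some (_, _, _)).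
  apply: functional_extensionality => i; rewrite raw_tapeE /upd !tape_store0.
  case: eqP => [->|_] //.
  by move: (tape_store0 k (f x) 0) => /(congr1 snd) /= ->.
have [||d Hd Hs] := sim_exec (n := (2 + c * (2 * c + 7)) * (size x).+1 ^ (2 * e + 1)) R' _ _ (sim_init M b01 b02 b12 x).
- by [].
- have n1 : 0 < (size x).+1 by [].
  have e1 : 0 < (size x).+1 ^ e by rewrite expn_gt0.
  have -> : (size x).+1 ^ (2 * e + 1) = (size x).+1 ^ e * (size x).+1 ^ e * (size x).+1.
    by rewrite mul2n -addnn !expnD expn1.
  move: ((size x).+1 ^ e) e1 Ht => N N1 Ht.
  have H1 : t' <= c * N * (2 * (size x + c * N) + 5).
    by apply: leq_trans Ht' _; apply: leq_mul => //; lia.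
  have H2 : 2 * (size x + c * N) + 5 <= (2 * c + 7) * (N * (size x).+1) by nia.
  have H3 : t' <= c * (2 * c + 7) * (N * N * (size x).+1).
    by apply: leq_trans H1 _; apply: leq_trans (leq_mul (leqnn _) H2) _; nia.
  have H4 : 0 < N * N * (size x).+1 by rewrite !muln_gt0 N1.
  by rewrite mulnDl; move: (N * N * _) (c * (2 * c + 7)) H3 H4 => A D; lia.
exists d; split=> //.
exact: sim_output Hs.
Qed.

(** * Polynomial bounds *)

(** Monotonicity is included because a bound is mostly evaluated at an upper estimate of the true
    size, notably under composition. *)
Definition polyb (P : nat -> nat) : Prop :=
  {homo P : m n / m <= n} /\ exists c k, forall n, P n <= c * n.+1 ^ k.

Lemma polyb_const a : polyb (fun _ => a).
Proof. by split=> //; exists a, 0 => n; rewrite muln1. Qed.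

Lemma polyb_id : polyb id.
Proof. by split=> //; exists 1, 1 => n; rewrite mul1n expn1. Qed.

Lemma polyb_add P Q : polyb P -> polyb Q -> polyb (fun n => P n + Q n).
Proof.
move=> [mP [c [k HP]]] [mQ [d [l HQ]]]; split.
  by move=> m n mn; apply: leq_add; auto.
exists (c + d), (k + l) => n; rewrite mulnDl; apply: leq_add.
  by apply: leq_trans (HP n) _; rewrite leq_mul2l leq_pexp2l ?leq_addr ?orbT.
by apply: leq_trans (HQ n) _; rewrite leq_mul2l leq_pexp2l ?leq_addl ?orbT.
Qed.

Lemma polyb_mul P Q : polyb P -> polyb Q -> polyb (fun n => P n * Q n).
Proof.
move=> [mP [c [k HP]]] [mQ [d [l HQ]]]; split.
  by move=> m n mn; apply: leq_mul; auto.
by exists (c * d), (k + l) => n; rewrite expnD mulnACA; apply: leq_mul.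
Qed.

Lemma polyb_comp P Q : polyb P -> polyb Q -> polyb (fun n => P (Q n)).
Proof.
move=> [mP [c [k HP]]] [mQ [d [l HQ]]]; split; first by move=> m n mn; auto.
(* Q(n) + 1 <= (d+1)(n+1)^l: the successor under the power is absorbed by d+1. *)
exists (c * d.+1 ^ k), (l * k) => n.
apply: leq_trans (HP _) _; rewrite -mulnA leq_mul2l expnM -expnMn.
apply/orP; right.
have [->|k0] := posnP k; first by rewrite !expn0.
rewrite leq_exp2r // mulSn; apply: leq_ltn_trans (HQ n) _.
by rewrite -{1}(add0n (d * _)) ltn_add2r expn_gt0.
Qed.

Lemma polyb_sum (I : Type) (r : seq I) (P : I -> nat -> nat) :
  (forall i, polyb (P i)) -> polyb (fun n => \sum_(i <- r) P i n).
Proof.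
move=> H; elim: r => [|i r IH].
  have -> : (fun n => \sum_(i <- [::]) P i n) = (fun _ => 0).
    by apply: functional_extensionality => n; rewrite big_nil.
  exact: polyb_const.
have -> : (fun n => \sum_(j <- i :: r) P j n) = (fun n => P i n + \sum_(j <- r) P j n).
  by apply: functional_extensionality => n; rewrite big_cons.
exact: polyb_add.
Qed.

Ltac polyb :=
  repeat first
    [ assumption
    | apply: polyb_const
    | apply: polyb_id
    | apply: polyb_add
    | apply: polyb_mul
    | match goal with H : polyb ?P |- polyb (fun n => ?P (@?Q n)) =>
        apply: (polyb_comp (P := P) (Q := Q) H) end ].

(** * Stack programs on finitely many nonempty registers *)

Definition st (l : seq (seq bool)) : store := nth [::] l.

Definition runs (p : cmd) (s s' : store) (T : nat) : Prop := exists2 t, t <= T & ev p s t s'.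

Lemma runsW p s s' T T' : runs p s s' T -> T <= T' -> runs p s s' T'.
Proof. by case=> t H E H'; exists t => //; apply: leq_trans H'. Qed.

Lemma runs_seq p q s1 s2 s3 T1 T2 : runs p s1 s2 T1 -> runs q s2 s3 T2 ->
  runs (Seq p q) s1 s3 (T1 + T2).+1.
Proof.
case=> t1 H1 E1 [t2 H2 E2]; exists (t1 + t2).+1; first by lia.
exact: ev_seq E1 E2.
Qed.

Lemma runs_skip s : runs Skip s s 1.
Proof. by exists 1 => //; exact: ev_skip. Qed.

Lemma upd_st l r v : upd (st l) r v = st (set_nth [::] l r v).
Proof. by apply: functional_extensionality => i; rewrite /upd /st nth_set_nth. Qed.

Lemma runs_push r b l : runs (Push r b) (st l) (st (set_nth [::] l r (b :: nth [::] l r))) 1.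
Proof. by exists 1 => //; rewrite -upd_st; exact: ev_push. Qed.

Lemma runs_pop0 r p0 p1 p2 l s' T : nth [::] l r = [::] -> runs p0 (st l) s' T ->
  runs (PopC r p0 p1 p2) (st l) s' T.+1.
Proof. by move=> E [t H H']; exists t.+1 => //; apply: ev_pop0. Qed.

Lemma runs_pop r p0 p1 p2 l b w s' T : nth [::] l r = b :: w ->
  runs (if b then p2 else p1) (st (set_nth [::] l r w)) s' T ->
  runs (PopC r p0 p1 p2) (st l) s' T.+1.
Proof.
move=> E [t H H']; exists t.+1 => //; case: b E H' => E H'.
  by apply: ev_pop2 E _; rewrite upd_st.
by apply: ev_pop1 E _; rewrite upd_st.
Qed.

Arguments runs_pop {r p0 p1 p2 l b w s' T}.

Lemma runs_while0 r p l : nth [::] l r = [::] -> runs (While r p) (st l) (st l) 1.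
Proof. by move=> E; exists 1 => //; apply: ev_while0. Qed.

Lemma runs_while r p l s2 s3 T1 T2 : nth [::] l r <> [::] -> runs p (st l) s2 T1 ->
  runs (While r p) s2 s3 T2 -> runs (While r p) (st l) s3 (T1 + T2).+1.
Proof.
move=> /eqP E [t1 H1 E1] [t2 H2 E2]; exists (t1 + t2).+1; first by lia.
exact: ev_while E E1 E2.
Qed.

Lemma runs_size p l l' T r : runs p (st l) (st l') T ->
  size (nth [::] l' r) <= size (nth [::] l r) + T.
Proof. by case=> t H /ev_size /(_ r) H'; rewrite /st in H'; lia. Qed.

Lemma st_ext l l' : (forall i, nth [::] l i = nth [::] l' i) -> st l = st l'.
Proof. by move=> H; apply: functional_extensionality. Qed.

(** Relocation of a subroutine above the registers in use, which it then cannot touch; [runs_shift]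
    is the resulting frame rule. *)
Fixpoint shift (d : nat) (p : cmd) : cmd :=
  match p with
  | Skip => Skip
  | Push r b => Push (d + r) b
  | PopC r p0 p1 p2 => PopC (d + r) (shift d p0) (shift d p1) (shift d p2)
  | Seq p q => Seq (shift d p) (shift d q)
  | While r p => While (d + r) (shift d p)
  end.

Definition glue (d : nat) (L s : store) : store :=
  fun r => if r < d then L r else s (r - d).

Lemma glue_upd d L s r v : upd (glue d L s) (d + r) v = glue d L (upd s r v).
Proof.
apply: functional_extensionality => i; rewrite /upd /glue.
case: ltnP => H; first by case: eqP => // E; lia.
by rewrite -(eqn_add2l d (i - d)) subnKC.
Qed.

Lemma glueE d L s r : glue d L s (d + r) = s r.
Proof. by rewrite /glue ltnNge leq_addr addKn. Qed.

Lemma ev_shift d L p s t s' : ev p s t s' -> ev (shift d p) (glue d L s) t (glue d L s').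
Proof.
elim=> {p s t s'} /=.
- by move=> s; exact: ev_skip.
- move=> s r b; rewrite -glue_upd -[in b :: s r](glueE d L s r); exact: ev_push.
- by move=> s r p0 p1 p2 t s' E _ IH; apply: ev_pop0 => //; rewrite glueE.
- move=> s r p0 p1 p2 t s' l E _ IH; apply: ev_pop1; first by rewrite glueE; exact: E.
  by rewrite glue_upd.
- move=> s r p0 p1 p2 t s' l E _ IH; apply: ev_pop2; first by rewrite glueE; exact: E.
  by rewrite glue_upd.
- by move=> s1 s2 s3 p q t1 t2 _ H1 _ H2; apply: ev_seq H1 H2.
- by move=> s r p E; apply: ev_while0; rewrite glueE.
- by move=> s1 s2 s3 r p t1 t2 E _ H1 _ H2; apply: ev_while H1 H2; rewrite glueE.
Qed.

Lemma st_cat l x : st (l ++ x) = glue (size l) (st l) (st x).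
Proof. by apply: functional_extensionality => i; rewrite /st /glue nth_cat. Qed.

Lemma runs_shift l p x y T : runs p (st x) (st y) T ->
  runs (shift (size l) p) (st (l ++ x)) (st (l ++ y)) T.
Proof. by case=> t H E; exists t => //; rewrite !st_cat; apply: ev_shift. Qed.

(** * Register transfers and the pairing of words *)

Definition Clear a := While a (PopC a Skip Skip Skip).
Definition Move a b := While a (PopC a Skip (Push b false) (Push b true)).
Definition Dup a b c := While a (PopC a Skip (Seq (Push b false) (Push c false))
  (Seq (Push b true) (Push c true))).
Definition DblMove a b := While a (PopC a Skip (Seq (Push b false) (Push b false))
  (Seq (Push b true) (Push b true))).

Fixpoint dbl (u : seq bool) : seq bool := if u is b :: u' then b :: b :: dbl u' else [::].
(** The terminator 01 cannot be confused with a doubled bit. Only the first component is doubled, so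
    a list nested to the right has size linear in the sizes of its entries. *)
Definition encpair (u v : seq bool) := dbl u ++ false :: true :: v.

Lemma size_dbl u : size (dbl u) = (size u).*2.
Proof. by elim: u => //= b u ->. Qed.

Lemma dbl_cat u v : dbl (u ++ v) = dbl u ++ dbl v.
Proof. by elim: u => //= b u ->. Qed.

Lemma size_encpair u v : size (encpair u v) = (size u).*2 + (size v).+2.
Proof. by rewrite size_cat size_dbl. Qed.

Definition sset (l : seq (seq bool)) r v := set_nth [::] l r v.

Lemma sset_nth l r v i : nth [::] (sset l r v) i = if i == r then v else nth [::] l i.
Proof. exact: nth_set_nth. Qed.

Lemma runs_clear a l : runs (Clear a) (st l) (st (sset l a [::])) (3 * size (nth [::] l a) + 1).
Proof.
move E: (nth [::] l a) => w; elim: w l E => [|b w IH] l E.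
  rewrite (st_ext (l := sset l a [::]) (l' := l)); first exact: runs_while0.
  by move=> i; rewrite sset_nth; case: eqP => [->|].
apply: runsW.
  apply: (runs_while (s2 := st (sset l a w))); first by rewrite E.
    by apply: (runs_pop E); case: b {E}; exact: runs_skip.
  rewrite (st_ext (l := sset l a [::]) (l' := sset (sset l a w) a [::])).
    by apply: IH; rewrite sset_nth eqxx.
  by move=> i; rewrite !sset_nth; case: eqP.
rewrite /=; lia.
Qed.

Lemma runs_move a b l : a != b ->
  runs (Move a b) (st l) (st (sset (sset l b (rev (nth [::] l a) ++ nth [::] l b)) a [::]))
    (3 * size (nth [::] l a) + 1).
Proof.
move=> ab; move E: (nth [::] l a) => w; elim: w l E => [|x w IH] l E.
  rewrite (st_ext (l' := l)); first exact: runs_while0.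
  by move=> i; rewrite !sset_nth; case: eqP => [->|_] //; case: eqP => [->|].
apply: runsW.
  apply: (runs_while (s2 := st (sset (sset l a w) b (x :: nth [::] l b)))); first by rewrite E.
    apply: (runs_pop E) => /=.
    have -> : x :: nth [::] l b = x :: nth [::] (sset l a w) b.
      by rewrite sset_nth eq_sym (negPf ab).
    by case: (x); exact: runs_push.
  set l1 := sset _ b _.
  rewrite [X in runs _ _ X](st_ext (l' := sset (sset l1 b (rev w ++ nth [::] l1 b)) a [::])).
    by apply: IH; rewrite /l1 !sset_nth (negPf ab) eqxx.
  move=> i; rewrite /l1 !sset_nth eqxx rev_cons cat_rcons.
  by case: eqP => // _; case: eqP.
rewrite /=; lia.
Qed.

Lemma runs_dup a b c l : a != b -> a != c -> b != c ->
  runs (Dup a b c) (st l) (st (sset (sset (sset l b (rev (nth [::] l a) ++ nth [::] l b))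
      c (rev (nth [::] l a) ++ nth [::] l c)) a [::]))
    (5 * size (nth [::] l a) + 1).
Proof.
move=> ab ac bc; move E: (nth [::] l a) => w; elim: w l E => [|x w IH] l E.
  rewrite (st_ext (l' := l)); first exact: runs_while0.
  move=> i; rewrite !sset_nth; case: eqP => [->|_] //; case: eqP => [->|] //.
  by case: eqP => [->|].
apply: runsW.
  apply: (runs_while (s2 := st (sset (sset (sset l a w) b (x :: nth [::] l b)) c (x :: nth [::] l c)))).
  - by rewrite E.
  - apply: (runs_pop E) => /=.
    have Eb : x :: nth [::] l b = x :: nth [::] (sset l a w) b.
      by rewrite sset_nth eq_sym (negPf ab).
    have Ec : x :: nth [::] l c = x :: nth [::] (sset (sset l a w) b (x :: nth [::] l b)) c.
      by rewrite !sset_nth eq_sym (negPf bc) eq_sym (negPf ac).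
    by rewrite Ec Eb; case: (x); apply: (runs_seq (T1 := 1) (T2 := 1)); exact: runs_push.
  set l1 := sset _ c _.
  rewrite [X in runs _ _ X](st_ext (l' := sset (sset (sset l1 b (rev w ++ nth [::] l1 b)) c
      (rev w ++ nth [::] l1 c)) a [::])).
    by apply: IH; rewrite /l1 !sset_nth (negPf ac) (negPf ab) eqxx.
  move=> i; rewrite /l1 !sset_nth !eqxx (negPf bc) rev_cons !cat_rcons.
  by case: eqP => // _; case: eqP => // _; case: eqP.
rewrite /=; lia.
Qed.

Lemma runs_dblmove a b l : a != b ->
  runs (DblMove a b) (st l) (st (sset (sset l b (dbl (rev (nth [::] l a)) ++ nth [::] l b)) a [::]))
    (5 * size (nth [::] l a) + 1).
Proof.
move=> ab; move E: (nth [::] l a) => w; elim: w l E => [|x w IH] l E.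
  rewrite (st_ext (l' := l)); first exact: runs_while0.
  by move=> i; rewrite !sset_nth; case: eqP => [->|_] //; case: eqP => [->|].
apply: runsW.
  apply: (runs_while (s2 := st (sset (sset (sset l a w) b (x :: nth [::] l b)) b
     (x :: x :: nth [::] l b)))); first by rewrite E.
    apply: (runs_pop E) => /=.
    have E1 : x :: nth [::] l b = x :: nth [::] (sset l a w) b.
      by rewrite sset_nth eq_sym (negPf ab).
    have E2 : x :: x :: nth [::] l b = x :: nth [::] (sset (sset l a w) b (x :: nth [::] l b)) b.
      by rewrite !sset_nth eqxx.
    by rewrite E2 E1; case: (x); apply: (runs_seq (T1 := 1) (T2 := 1)); exact: runs_push.
  set l1 := sset _ b (_ :: _ :: _).
  rewrite [X in runs _ _ X](st_ext (l' := sset (sset l1 b (dbl (rev w) ++ nth [::] l1 b)) a [::])).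
    by apply: IH; rewrite /l1 !sset_nth (negPf ab) eqxx.
  move=> i; rewrite /l1 !sset_nth eqxx rev_cons -cats1 dbl_cat -catA.
  by case: eqP => // _; case: eqP.
rewrite /=; lia.
Qed.

(** Register 1 holds a flag that keeps the loop alive. A doubled bit is sent to register 2; the
    terminator 01 removes the flag. *)
Definition Unpair := Seq (Push 1 true) (While 1 (PopC 0 Skip
  (PopC 0 Skip (Push 2 false) (PopC 1 Skip Skip Skip)) (PopC 0 Skip Skip (Push 2 true)))).

Lemma runs_unpair u v l :
  runs Unpair (st [:: encpair u v, [::], [::] & l]) (st [:: v, [::], rev u & l]) (4 * size u + 10).
Proof.
suff H w : runs (While 1 (PopC 0 Skip
  (PopC 0 Skip (Push 2 false) (PopC 1 Skip Skip Skip)) (PopC 0 Skip Skip (Push 2 true))))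
  (st [:: encpair u v, [:: true], w & l]) (st [:: v, [::], rev u ++ w & l]) (4 * size u + 8).
  apply: (runsW (T := (1 + (4 * size u + 8)).+1)); last by lia.
  by apply: runs_seq (runs_push _ _ _) _; move: (H [::]); rewrite cats0.
elim: u w => [|b u IH] w.
  apply: runsW; first apply: runs_while => //.
  - apply: (runs_pop (b := false)) => //=.
    apply: (runs_pop (b := true)) => //=.
    by apply: (runs_pop (b := true)) => //=; exact: runs_skip.
  - exact: runs_while0.
  - by [].
apply: runsW; first apply: (runs_while (s2 := st [:: encpair u v, [:: true], b :: w & l]) (T1 := 3)) => //.
- apply: (runs_pop (b := b) (w := b :: encpair u v)) => //=.
  case: b => /=.
    by apply: (runs_pop (b := true) (w := encpair u v)) => //=; exact: runs_push.
  by apply: (runs_pop (b := false) (w := encpair u v)) => //=; exact: runs_push.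
- by rewrite rev_cons cat_rcons; exact: IH.
- by rewrite /=; lia.
Qed.

Fixpoint PushStr (r : nat) (w : seq bool) : cmd :=
  if w is b :: w' then Seq (PushStr r w') (Push r b) else Skip.

Lemma runs_pushstr r w l :
  runs (PushStr r w) (st l) (st (sset l r (w ++ nth [::] l r))) (2 * size w + 1).
Proof.
elim: w => [|b w IH] /=.
  rewrite [X in runs _ _ X](st_ext (l' := l)); first exact: runs_skip.
  by move=> i; rewrite sset_nth; case: eqP => [->|].
apply: runsW; first apply: runs_seq IH _.
  have := runs_push r b (sset l r (w ++ nth [::] l r)); rewrite sset_nth eqxx.
  rewrite [X in runs _ _ X _ -> _](st_ext (l' := sset l r (b :: w ++ nth [::] l r))); first exact.
  by move=> i; rewrite nth_set_nth /= !sset_nth; case: eqP.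
by lia.
Qed.

(** * Polynomial-time functions on encoded data *)

Class Enc (A : Type) := MkEnc { enc : A -> seq bool }.

Record bits := Bits { unbits : seq bool }.

#[export] Instance enc_bits : Enc bits := MkEnc unbits.
#[export] Instance enc_prod A B (eA : Enc A) (eB : Enc B) : Enc (A * B) :=
  MkEnc (fun p => encpair (enc p.1) (enc p.2)).
#[export] Instance enc_seq A (eA : Enc A) : Enc (seq A) :=
  MkEnc (foldr (fun a r => encpair (enc a) r) [::]).

(* All elements of a finite type have codes of the same length, so that
   the size of a list over it depends on its length only. *)
Definition code_fin (T : finType) (a : T) : seq bool :=
  nseq (enum_rank a) true ++ nseq (#|T| - enum_rank a) false.
Definition enc_fin (T : finType) : Enc T := MkEnc (@code_fin T).
#[export] Instance enc_bool : Enc bool := enc_fin bool.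
#[export] Instance enc_unit : Enc unit := enc_fin unit.
#[export] Instance enc_ord n : Enc 'I_n := enc_fin 'I_n.

Definition sz A (eA : Enc A) (a : A) : nat := size (enc a).
Arguments sz {A eA} a.

(** All registers other than 0 are empty before and after, so programs can be chained as they are
    and, once relocated, called as subroutines. *)
Definition fp A B (eA : Enc A) (eB : Enc B) (f : A -> B) : Prop :=
  exists p P, polyb P /\ forall a, runs p (st [:: enc a]) (st [:: enc (f a)]) (P (sz a)).
Arguments fp {A B eA eB} f.

Lemma fp_size A B (eA : Enc A) (eB : Enc B) (f : A -> B) : fp f ->
  exists P, polyb P /\ forall a, sz (f a) <= P (sz a).
Proof.
move=> [p [P [HP H]]]; exists (fun n => n + P n); split; first by polyb.
by move=> a; have /= := runs_size 0 (H a).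
Qed.

Lemma sz_fin (T : finType) (a : T) : size (code_fin a) = #|T|.
Proof. by rewrite size_cat !size_nseq subnKC // ltnW. Qed.

Lemma sz_pair A B (eA : Enc A) (eB : Enc B) (a : A) (b : B) : sz (a, b) = (sz a).*2 + (sz b).+2.
Proof. exact: size_encpair. Qed.

Lemma sz_cons A (eA : Enc A) (a : A) (l : seq A) : sz (a :: l) = (sz a).*2 + (sz l).+2.
Proof. exact: size_encpair. Qed.

Lemma sz_nil A (eA : Enc A) : sz ([::] : seq A) = 0.
Proof. by []. Qed.

Lemma sz_cat A (eA : Enc A) (l l' : seq A) : sz (l ++ l') = sz l + sz l'.
Proof. by elim: l => //= a l IH; rewrite !sz_cons IH; lia. Qed.

Lemma size_sz A (eA : Enc A) (l : seq A) : size l <= sz l.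
Proof. by elim: l => //= a l IH; rewrite sz_cons; lia. Qed.

Lemma runs_eq p s s1 s2 T : runs p s s1 T -> s1 = s2 -> runs p s s2 T.
Proof. by move=> H <-. Qed.

Ltac rstep lem := eapply runs_seq; [apply: lem => // | rewrite /sset /= ?cats0 ?revK].
Ltac rlast lem := eapply runs_eq; [apply: lem => // | rewrite /sset /= ?cats0 ?revK].
Ltac nth_eq := move=> [|[|[|[|[|[|[|[|?]]]]]]]] //=.
Ltac st_eq := apply: st_ext; nth_eq.
Ltac size_lia := rewrite /sset /= ?cats0 ?(size_rev, size_cat, size_dbl, size_nseq) /=; lia.

Section Closure.
Context {A B C : Type} {eA : Enc A} {eB : Enc B} {eC : Enc C}.

Lemma fp_ext (f g : A -> B) : f =1 g -> fp f -> fp g.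
Proof. by move=> E [p [P [HP H]]]; exists p, P; split => // a; rewrite -E. Qed.

Lemma fp_id : fp (fun a : A => a).
Proof. by exists Skip, (fun=> 1); split; [polyb | move=> a; exact: runs_skip]. Qed.

Lemma fp_const (b : B) : fp (fun _ : A => b).
Proof.
exists (Seq (Clear 0) (PushStr 0 (enc b))), (fun n => 3 * n + (2 * sz b + 3)); split; first by polyb.
move=> a; eapply runsW.
  rstep runs_clear; rlast runs_pushstr; st_eq.
rewrite /sz; size_lia.
Qed.

Lemma fp_comp (f : A -> B) (g : B -> C) : fp f -> fp g -> fp (fun a => g (f a)).
Proof.
move=> [p [P [HP Hp]]] [q [Q [HQ Hq]]].
exists (Seq p q), (fun n => P n + Q (n + P n) + 1); split; first by polyb.
move=> a; apply: runsW (runs_seq (Hp a) (Hq (f a))) _.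
have /= := HQ.1 _ _ (runs_size 0 (Hp a)).
by rewrite -!/(sz _); lia.
Qed.

(** The argument is duplicated and both programs run relocated to register 4. The reversed [f a]
    waits in register 1 until it can be doubled in front of [g a]. *)
Lemma fp_pair (f : A -> B) (g : A -> C) : fp f -> fp g -> fp (fun a => (f a, g a)).
Proof.
move=> [p [P [HP Hp]]] [q [Q [HQ Hq]]].
exists (Seq (Move 0 1) (Seq (Dup 1 4 0) (Seq (shift 4 p) (Seq (Move 4 1) (Seq (Move 0 2)
  (Seq (Move 2 4) (Seq (shift 4 q) (Seq (Move 4 2) (Seq (Move 2 0)
  (Seq (PushStr 0 [:: false; true]) (DblMove 1 0))))))))))).
exists (fun n => 30 * (n + P n + Q n + 1)); split; first by polyb.
move=> a; have /= s1 := runs_size 0 (Hp a); have /= s2 := runs_size 0 (Hq a).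
eapply runsW.
  rstep runs_move; rstep runs_dup.
  rstep (runs_shift [:: enc a; [::]; [::]; [::]] (Hp a)).
  rstep runs_move; rstep runs_move; rstep runs_move.
  rstep (runs_shift [:: [::]; rev (enc (f a)); [::]; [::]] (Hq a)).
  rstep runs_move; rstep runs_move; rstep (runs_pushstr 0 [:: false; true]); rlast runs_dblmove; st_eq.
rewrite /sz in s1 s2 *; size_lia.
Qed.

Lemma fp_fst : fp (fun p : A * B => p.1).
Proof.
exists (Seq Unpair (Seq (Clear 0) (Move 2 0))), (fun n => 30 * (n + 1)); split; first by polyb.
move=> [a b]; eapply runsW.
  rewrite (st_ext (l' := [:: encpair (enc a) (enc b); [::]; [::]])); last by nth_eq.
  rstep runs_unpair; rstep runs_clear; rlast runs_move; st_eq.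
by rewrite sz_pair /sz; size_lia.
Qed.

Lemma fp_snd : fp (fun p : A * B => p.2).
Proof.
exists (Seq Unpair (Clear 2)), (fun n => 30 * (n + 1)); split; first by polyb.
move=> [a b]; eapply runsW.
  rewrite (st_ext (l' := [:: encpair (enc a) (enc b); [::]; [::]])); last by nth_eq.
  rstep runs_unpair; rlast runs_clear; st_eq.
by rewrite sz_pair /sz; size_lia.
Qed.

End Closure.

Lemma fp_cons A B (eA : Enc A) (eB : Enc B) (f : A -> B) (g : A -> seq B) : fp f -> fp g -> fp (fun a => f a :: g a).
Proof.
move=> Hf Hg; have [p [P [HP H]]] := fp_pair Hf Hg.
by exists p, P.
Qed.

Lemma fp_nil A B (eA : Enc A) (eB : Enc B) : fp (fun _ : A => [::] : seq B).
Proof. exact: fp_const. Qed.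

Section Cases.
Context {A B C : Type} {eA : Enc A} {eB : Enc B} {eC : Enc C}.

(* A nonempty list is encoded as the pair of its head and tail. *)
Lemma fp_seqcase0 (f : A -> C) (g : A * (B * seq B) -> C) : fp f -> fp g ->
  fp (fun p : A * seq B => if p.2 is b :: l then g (p.1, (b, l)) else f p.1).
Proof.
move=> [p [P [HP Hp]]] [q [Q [HQ Hq]]].
(* Emptiness of the list shows only by popping from its code; [re b] puts the popped bit back and
   rebuilds the pair before [q] runs. *)
pose re b := Seq (Push 0 b) (Seq (PushStr 0 [:: false; true]) (Seq (DblMove 2 0) q)).
exists (Seq Unpair (PopC 0 (Seq (Move 2 0) p) (re false) (re true))).
exists (fun n => 30 * (n + P n + Q n + 1)); split; first by polyb.
move=> [a l]; have mP : P (sz a) <= P (sz (a, l)) by apply: HP.1; rewrite sz_pair; lia.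
case: l mP => [|b l] mP /=; eapply runsW.
- rewrite (st_ext (l' := [:: encpair (enc a) [::]; [::]; [::]])); last by nth_eq.
  rstep runs_unpair; apply: runs_pop0 => //; rstep runs_move.
  rewrite (st_ext (l' := [:: enc a])); first exact: Hp.
  by nth_eq.
- by move: mP; rewrite !sz_pair sz_nil; rewrite /sz; size_lia.
- rewrite (st_ext (l' := [:: encpair (enc a) (@enc _ (enc_seq eB) (b :: l)); [::]; [::]])); last by nth_eq.
  rstep runs_unpair.
  apply: (runsW (T := (1 + (2 * 2 + 1 + (5 * sz a + 1 + Q (sz (a, (b, l)))).+1).+1).+2)); last exact: leqnn.
  case E : (@enc _ (enc_seq eB) (b :: l)) => [|x w].
    by move/(congr1 size): E; rewrite -[size (enc _)]/(@sz _ (enc_seq eB) (b :: l)) sz_cons /=; lia.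
  apply: (runs_pop (b := x) (w := w)) => //.
  have H : runs (re x) (st [:: w; [::]; rev (enc a)]) (st [:: enc (g (a, (b, l)))])
      (1 + (2 * 2 + 1 + (5 * sz a + 1 + Q (sz (a, (b, l)))).+1).+1).+1.
    eapply runsW.
      rstep runs_push; rstep (runs_pushstr 0 [:: false; true]); rstep runs_dblmove.
      rewrite (st_ext (l' := [:: enc (a, (b, l))])); first exact: Hq.
      by case=> [|[|[|[|i]]]] //=; rewrite -E.
    by rewrite /sz; size_lia.
  by case: (x) H => H; apply: runsW H _.
- have E : sz (a, b :: l) = sz (a, (b, l)) by [].
  by rewrite E sz_pair /sz; size_lia.
Qed.

Lemma fp_seqcase (h : A -> seq B) (f : A -> C) (g : A * (B * seq B) -> C) : fp h -> fp f -> fp g ->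
  fp (fun a => if h a is b :: l then g (a, (b, l)) else f a).
Proof.
move=> Hh Hf Hg; apply: (fp_comp (fp_pair fp_id Hh) (fp_seqcase0 Hf Hg)).
Qed.

Fixpoint PopN (r n : nat) : cmd := if n is n'.+1 then PopC r Skip (PopN r n') (PopN r n') else Skip.

Lemma runs_popn r w v l : nth [::] l r = w ++ v ->
  runs (PopN r (size w)) (st l) (st (sset l r v)) (size w).+1.
Proof.
elim: w l => [|b w IH] l E.
  rewrite (st_ext (l' := sset l r v)); first exact: runs_skip.
  by move=> i; rewrite sset_nth; case: eqP => [->|].
apply: (runs_pop E) => /=.
rewrite (st_ext (l := sset l r v) (l' := sset (sset l r (w ++ v)) r v)); last first.
  by move=> i; rewrite !sset_nth; case: eqP.
by case: b {E}; apply: IH; rewrite nth_set_nth /= eqxx.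
Qed.

(* Reads the code [dbl (nseq i true ++ nseq (n - i) false) ++ [:: false; true]] of the
   [i]-th element of an [n]-element type and continues with the [i]-th program. *)
Fixpoint dispatch (n : nat) (ps : seq cmd) : cmd :=
  if ps is p :: ps' then
    PopC 0 Skip (Seq (PopN 0 ((n.*2).+1)) p) (Seq (PopN 0 1) (dispatch n.-1 ps'))
  else Skip.

Lemma runs_dispatch n ps i w s T : i < size ps -> i < n ->
  runs (nth Skip ps i) (st [:: w]) s T ->
  runs (dispatch n ps) (st [:: encpair (nseq i true ++ nseq (n - i) false) w]) s (T + 4 * n + 10).
Proof.
elim: ps i n => [|p ps IH] [|i] [|n] //= Hi Hn H.
  pose u := false :: dbl (nseq n false) ++ [:: false; true].
  have Eu : n.+1.*2.+1 = size u by rewrite /= size_cat size_dbl size_nseq /=; lia.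
  have := @runs_popn 0 u w [:: u ++ w] erefl.
  rewrite -Eu /u /= -catA => Hpop.
  eapply runsW.
    apply: runs_pop => //=.
    apply: runs_seq; first exact: Hpop.
    exact: H.
  by lia.
eapply runsW.
  apply: runs_pop => //=.
  apply: runs_seq.
    by apply: (@runs_popn 0 [:: true] (encpair (nseq i true ++ nseq (n - i) false) w)).
  exact: IH.
by rewrite /=; lia.
Qed.

(** Program and bound may depend on [t]. Finite choice collects the programs in a [dispatch] table,
    and the sum of the bounds serves for all of them. *)
Lemma fp_fincase0 (T : finType) (eT := enc_fin T) (g : T -> A -> B) : (forall t, fp (g t)) ->
  fp (fun p : T * A => g p.1 p.2).
Proof.
move=> H.
have {H} [ps Hps] : exists ps : T -> cmd, forall t, exists P, polyb P /\
    forall a, runs (ps t) (st [:: enc a]) (st [:: enc (g t a)]) (P (sz a)).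
  have [ps H'] := fin_all_exists (fun t => H t); by exists ps.
have [Ps HPs] := fin_all_exists (fun t => Hps t).
exists (dispatch #|T| [seq ps t | t <- enum T]).
exists (fun n => (\sum_(t <- enum T) Ps t n) + (4 * #|T| + 10)); split.
  apply: polyb_add; last exact: polyb_const.
  by apply: polyb_sum => t; case: (HPs t).
move=> [t a] /=.
have Ht : enum_rank t < size [seq ps t | t <- enum T] by rewrite size_map -cardE.
apply: runsW.
  apply: (@runs_dispatch #|T| [seq ps t | t <- enum T] (enum_rank t) (enc a) _ (Ps t (sz a))) => //.
  rewrite (nth_map t) -?cardE //.
  have -> : nth t (enum T) (enum_rank t) = t by rewrite -(enum_val_nth t) enum_rankK.
  by case: (HPs t).
rewrite -addnA leq_add2r.
have := perm_big (op := addn) _ (perm_to_rem (mem_enum T t)) => /= ->.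
rewrite big_cons; apply: leq_trans (leq_addr _ _).
by case: (HPs t) => HP _; apply: HP.1; rewrite sz_pair; lia.
Qed.

Lemma fp_fincase (T : finType) (eT := enc_fin T) (h : A -> T) (g : T -> A -> B) : fp h ->
  (forall t, fp (g t)) -> fp (fun a => g (h a) a).
Proof. by move=> Hh /fp_fincase0 H; apply: (fp_comp (fp_pair Hh fp_id) H). Qed.

End Cases.

Lemma fp_if A B (eA : Enc A) (eB : Enc B) (c : A -> bool) (f g : A -> B) :
  fp c -> fp f -> fp g -> fp (fun a => if c a then f a else g a).
Proof.
move=> Hc Hf Hg; apply: fp_ext (fp_fincase (g := fun b a => if b then f a else g a) Hc _) => //.
by case.
Qed.

(** * Bounded iteration along a list *)

Section Fold.
Context {A C S : Type} {eA : Enc A} {eC : Enc C} {eS : Enc S}.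
Variables (p : cmd) (step : C * (S * A) -> S) (P : nat -> nat).
Hypothesis HP : polyb P.
Hypothesis Hp : forall x, runs p (st [:: enc x]) (st [:: enc (step x)]) (P (sz x)).

(** Register 0 holds the rest of the list, 3 the parameter, 4 the state. The code of (c, (s, a)) is
    assembled back to front in register 5, and [Dup] keeps a copy of the parameter for the next
    round. *)
Definition fold_body :=
  Seq Unpair (Seq (Move 2 5) (Seq (PushStr 5 [:: false; true]) (Seq (Move 4 1)
  (Seq (DblMove 1 5) (Seq (PushStr 5 [:: false; true]) (Seq (Move 3 1) (Seq (Dup 1 3 2)
  (Seq (Move 2 1) (Seq (DblMove 1 5) (Seq (shift 5 p) (Seq (Move 5 1) (Move 1 4)))))))))))).

Lemma runs_fold_body c s a l N : sz c <= N -> sz s <= N -> sz a <= N ->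
  sz (step (c, (s, a))) <= N ->
  runs fold_body (st [:: enc (a :: l); [::]; [::]; enc c; enc s])
    (st [:: enc l; [::]; [::]; enc c; enc (step (c, (s, a)))]) (60 * (N + 1) + P (6 * N + 6)).
Proof.
rewrite {1 2 3 4}/sz => cN sN aN rN.
eapply runsW.
  rstep (runs_unpair (enc a) (enc l) [:: enc c; enc s]).
  rstep runs_move; rstep (runs_pushstr 5 [:: false; true]); rstep runs_move; rstep runs_dblmove.
  rstep (runs_pushstr 5 [:: false; true]); rstep runs_move; rstep runs_dup; rstep runs_move.
  rstep runs_dblmove.
  rstep (runs_shift [:: enc l; [::]; [::]; enc c; [::]] (Hp (c, (s, a)))).
  rstep runs_move; rlast runs_move; st_eq.
have : P (sz (c, (s, a))) <= P (6 * N + 6) by apply: HP.1; rewrite !sz_pair /sz; lia.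
by size_lia.
Qed.

Lemma runs_fold_loop c N l s : sz c <= N -> sz l <= N ->
  (forall l1 l2, l = l1 ++ l2 -> sz (foldl (fun s a => step (c, (s, a))) s l1) <= N) ->
  runs (While 0 fold_body) (st [:: enc l; [::]; [::]; enc c; enc s])
    (st [:: [::]; [::]; [::]; enc c; enc (foldl (fun s a => step (c, (s, a))) s l)])
    (size l * (60 * (N + 1) + P (6 * N + 6)).+1 + 1).
Proof.
move=> cN; elim: l s => [|a l IH] s lN H; first exact: runs_while0.
have aN : sz a <= N by move: lN; rewrite sz_cons; lia.
have l'N : sz l <= N by move: lN; rewrite sz_cons; lia.
eapply runsW.
  apply: runs_while.
  - by move/(congr1 size); rewrite -[size _]/(sz (a :: l)) sz_cons /=; lia.
  - apply: (runs_fold_body l cN _ aN).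
      exact: (H [::] (a :: l)).
    exact: (H [:: a] l).
  - apply: IH => // l1 l2 E; apply: (H (a :: l1) l2); by rewrite E.
by rewrite /=; lia.
Qed.

End Fold.

(** A polynomial step repeated along a list may still produce a state of exponential size, so a
    bound on all intermediate states has to be supplied. *)
Lemma fp_foldl A C S (eA : Enc A) (eC : Enc C) (eS : Enc S) (step : C * (S * A) -> S)
    (s0 : C -> S) (l : C -> seq A) (P : nat -> nat) :
  fp step -> fp s0 -> fp l -> polyb P ->
  (forall c l1 l2, l c = l1 ++ l2 ->
    sz (foldl (fun s a => step (c, (s, a))) (s0 c) l1) <= P (sz c)) ->
  fp (fun c => foldl (fun s a => step (c, (s, a))) (s0 c) (l c)).
Proof.
move=> [p [Q [HQ Hp]]] Hs Hl HP HB.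
have [L [HL HL']] := fp_size Hl.
have [q [R [HR Hq]]] := fp_pair fp_id (fp_pair Hs Hl).
pose N n := n + P n + L n.
have HN : polyb N by rewrite /N; polyb.
exists (Seq q (Seq Unpair (Seq (Move 2 3) (Seq Unpair (Seq (Move 2 4)
  (Seq (While 0 (fold_body p)) (Seq (Clear 3) (Seq (Move 4 1) (Move 1 0))))))))).
exists (fun n => R n + N n * ((60 * (N n + 1) + Q (6 * N n + 6)) + 1) + 60 * (N n + 1)); split.
  by polyb.
move=> c.
have cN : sz c <= N (sz c) by rewrite /N; lia.
have lN : sz (l c) <= N (sz c) by move: (HL' c); rewrite /N; lia.
have sN l1 l2 : l c = l1 ++ l2 -> sz (foldl (fun s a => step (c, (s, a))) (s0 c) l1) <= N (sz c).
  by move/HB; rewrite /N; lia.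
have s0N := sN [::] (l c) erefl.
have fN := sN (l c) [::]; rewrite cats0 in fN.
eapply runsW.
  rstep Hq.
  rewrite (st_ext (l' := [:: encpair (enc c) (enc (s0 c, l c)); [::]; [::]])); last by nth_eq.
  rstep runs_unpair; rstep runs_move.
  rstep (runs_unpair (enc (s0 c)) (enc (l c)) [:: enc c]); rstep runs_move.
  rstep (runs_fold_loop (s := s0 c) HQ Hp cN lN).
  rstep runs_clear; rstep runs_move; rlast runs_move; st_eq.
move: (cN) (lN) (s0N) (fN erefl) (@size_sz _ eA (l c)); move: (N (sz c)) => n.
rewrite /sz /= => H2 H3 H4 H5 H6.
have H1 : size (l c) * (60 * (n + 1) + Q (6 * n + 6)).+1 <= n * (60 * (n + 1) + Q (6 * n + 6) + 1).
  by apply: leq_mul; lia.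
move: (size (l c) * _) (n * _) H1 => X Y H1.
by size_lia.
Qed.

(** The convenient criterion: if a round adds an amount that does not depend on the state, growth is
    additive and cannot compound. *)
Lemma fp_foldl_grow A C S (eA : Enc A) (eC : Enc C) (eS : Enc S) (step : C * (S * A) -> S)
    (s0 : C -> S) (l : C -> seq A) (P : nat -> nat) :
  fp step -> fp s0 -> fp l -> polyb P ->
  (forall c s a, sz (step (c, (s, a))) <= sz s + P (sz c + sz a)) ->
  fp (fun c => foldl (fun s a => step (c, (s, a))) (s0 c) (l c)).
Proof.
move=> Hst Hs Hl HP H.
have [L [HL HL']] := fp_size Hl; have [T [HT HT']] := fp_size Hs.
apply: (fp_foldl (P := fun n => T n + L n * P (n + L n))) => //; first by polyb.
move=> c l1 l2 E.
have l1L : sz l1 <= L (sz c) by move: (HL' c); rewrite E sz_cat; lia.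
have sl1 : size l1 <= L (sz c) := leq_trans (@size_sz _ eA l1) l1L.
apply: leq_trans (leq_add (HT' c) (leq_mul sl1 (leqnn _))).
elim: l1 {E sl1} (s0 c) l1L => [|a l1 IH] s /=; first by rewrite addn0.
rewrite sz_cons => l1L.
apply: leq_trans (IH _ _) _; first by lia.
have : P (sz c + sz a) <= P (sz c + L (sz c)) by apply: HP.1; lia.
by move: (H c s a); rewrite mulSn; lia.
Qed.

(** * Words as lists, and the passage to Turing machines *)

(** A word occurs in two representations: [bits] is stored verbatim, [seq bool] as a list of codes
    of bits, to which the list operations apply. The function is the identity on the underlying word
    and only changes the representation; [fp_implode] goes back. *)
Definition explode (x : bits) : seq bool := unbits x.

Lemma fp_explode : fp explode.
Proof.
pose w (b : bool) : seq bool := code_fin b.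
pose cw b := dbl (w b) ++ [:: false; true].
exists (Seq (Move 0 1) (While 1 (PopC 1 Skip (PushStr 0 (cw false)) (PushStr 0 (cw true))))).
exists (fun n => 30 * (n + 1)); split; first by polyb.
move=> [x].
have Hw b : size (cw b) = 6 by rewrite size_cat size_dbl /w sz_fin card_bool.
have H u v : runs (While 1 (PopC 1 Skip (PushStr 0 (cw false)) (PushStr 0 (cw true))))
    (st [:: enc v; rev u]) (st [:: enc (u ++ v)]) (16 * size u + 1).
  elim/last_ind: u v => [|u b IH] v.
    by rewrite (st_ext (l' := [:: enc v])); [exact: runs_while0|nth_eq].
  rewrite rev_rcons cat_rcons; apply: runsW.
    apply: (runs_while (T1 := 14) (s2 := st [:: enc (b :: v); rev u])) => //.
    apply: (runs_pop (b := b) (w := rev u)) => //=.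
    have Hb : runs (PushStr 0 (cw b)) (st [:: enc v; rev u]) (st [:: enc (b :: v); rev u]) 13.
      have <- : cw b ++ enc v = enc (b :: v) by rewrite /cw -catA.
      by have := runs_pushstr 0 (cw b) [:: enc v; rev u]; rewrite Hw.
    by case: b Hb.
  by rewrite size_rcons; lia.
eapply runsW.
  rstep runs_move.
  have := H x [::]; rewrite cats0 => H'.
  rewrite (st_ext (l' := [:: enc ([::] : seq bool); rev x])); first exact: H'.
  by nth_eq.
by rewrite /sz  /=; lia.
Qed.

Lemma fp_consb : fp (fun p : bool * bits => Bits (p.1 :: unbits p.2)).
Proof.
apply: (fp_fincase0 (g := fun b x => Bits (b :: unbits x))) => b.
exists (Push 0 b), (fun=> 1); split; first by polyb.
by move=> a; exact: runs_push.
Qed.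

Lemma sz_ord n (i : 'I_n) : sz i = n.
Proof. by rewrite /sz /= sz_fin card_ord. Qed.

Lemma sz_bool (b : bool) : sz b = 2.
Proof. by rewrite /sz /= sz_fin card_bool. Qed.

#[global] Opaque enc_prod enc_seq enc_bool enc_unit enc_ord enc_fin.

Section Derived.
Context {A B C : Type} {eA : Enc A} {eB : Enc B} {eC : Enc C}.

Lemma fp_proj1 (f : A -> B * C) : fp f -> fp (fun a => (f a).1).
Proof. by move=> H; exact: (fp_comp H fp_fst). Qed.

Lemma fp_proj2 (f : A -> B * C) : fp f -> fp (fun a => (f a).2).
Proof. by move=> H; exact: (fp_comp H fp_snd). Qed.

End Derived.

(** A hook, redefined below whenever further operations have been shown to stay in the class. *)
Ltac fp_user := fail.
Ltac fp_step :=
  first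
  [ assumption
  | exact: fp_id
  | exact: fp_fst
  | exact: fp_snd
  | exact: fp_const
  | fp_user
  | lazymatch goal with
    | |- fp (fun x => (@?f x, @?g x)) => apply: (fp_pair (f := f) (g := g))
    | |- fp (fun x => @?f x :: @?g x) => apply: (fp_cons (f := f) (g := g))
    | |- fp (fun x => (@?f x).1) => apply: (fp_proj1 (f := f))
    | |- fp (fun x => (@?f x).2) => apply: (fp_proj2 (f := f))
    | |- fp (fun x => if _ then _ else _) => apply: fp_if
    end ].
Ltac fp := repeat fp_step.

Section Lists.
Context {A C : Type} {eA : Enc A} {eC : Enc C}.

Lemma fp_catrev (l r : C -> seq A) : fp l -> fp r -> fp (fun c => catrev (l c) (r c)).
Proof.
move=> Hl Hr.
apply: fp_ext (fp_foldl_grow (step := fun x : C * (seq A * A) => x.2.2 :: x.2.1)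
  (P := fun n => 2 * n + 2) _ Hr Hl _ _).
- by move=> c; elim: (l c) (r c) => //= a l' IH r'; rewrite IH.
- by fp.
- by polyb.
- by move=> c s a /=; rewrite sz_cons; lia.
Qed.

Lemma fp_rev (l : C -> seq A) : fp l -> fp (fun c => rev (l c)).
Proof. by move=> H; apply: fp_catrev => //; exact: fp_nil. Qed.

Lemma fp_cat (l r : C -> seq A) : fp l -> fp r -> fp (fun c => l c ++ r c).
Proof.
move=> Hl Hr; apply: fp_ext (fp_catrev (fp_rev Hl) Hr) => c.
by rewrite catrevE revK.
Qed.

End Lists.

Lemma fp_map A B C (eA : Enc A) (eB : Enc B) (eC : Enc C) (f : C * A -> B) (l : C -> seq A) : fp f -> fp l ->
  fp (fun c => [seq f (c, a) | a <- l c]).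
Proof.
move=> Hf Hl; have [P [HP HP']] := fp_size Hf.
have H : fp (fun c => foldl (fun s a => f (c, a) :: s) [::] (l c)).
  apply: (fp_foldl_grow (s0 := fun=> [::]) (step := fun x : C * (seq B * A) => f (x.1, x.2.2) :: x.2.1)
    (P := fun n => 2 * P (3 * n + 2) + 2)) => //.
  - by apply: fp_cons; [apply: (fp_comp (f := fun x => (x.1, x.2.2))) => //; fp|fp].
  - by fp.
  - by polyb.
  - move=> c s a /=; rewrite sz_cons; have := HP' (c, a).
    have : P (sz (c, a)) <= P (3 * (sz c + sz a) + 2) by apply: HP.1; rewrite sz_pair; lia.
    by lia.
apply: fp_ext (fp_rev H) => c.
have E l' s : foldl (fun s a => f (c, a) :: s) s l' = rev [seq f (c, a) | a <- l'] ++ s.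
  by elim: l' s => //= a l' IH s; rewrite IH rev_cons cat_rcons.
by rewrite E cats0 revK.
Qed.

Lemma sz_rev A (eA : Enc A) (l : seq A) : sz (rev l) = sz l.
Proof. by elim: l => // a l IH; rewrite rev_cons -cats1 sz_cat !sz_cons IH sz_nil; lia. Qed.

Lemma fp_flatten A C (eA : Enc A) (eC : Enc C) (l : C -> seq (seq A)) : fp l ->
  fp (fun c => flatten (l c)).
Proof.
move=> Hl.
have H : fp (fun c => foldl (fun s a => catrev a s) [::] (l c)).
  apply: (fp_foldl_grow (s0 := fun=> [::]) (step := fun x : C * (seq A * seq A) => catrev x.2.2 x.2.1)
    (P := fun n => n)).
  - by apply: fp_catrev; fp.
  - by fp.
  - by fp.
  - by polyb.
  - move=> c s a /=; rewrite catrevE sz_cat.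
    by rewrite sz_rev; lia.
apply: fp_ext (fp_rev H) => c.
have E l' s : foldl (fun s a => catrev a s) s l' = rev (flatten l') ++ s.
  by elim: l' s => //= a l' IH s; rewrite IH rev_cat -catA catrevE.
by rewrite E cats0 revK.
Qed.

Ltac fp_user ::=
  lazymatch goal with
  | |- fp (fun x => @?f x ++ @?g x) => apply: (fp_cat (l := f) (r := g))
  | |- fp (fun x => rev (@?f x)) => apply: (fp_rev (l := f))
  | |- fp (fun x => flatten (@?f x)) => apply: (fp_flatten (l := f))
  end.

Lemma fp_implode : fp Bits.
Proof.
have H : fp (fun x : seq bool => foldl (fun s b => Bits (b :: unbits s)) (Bits [::]) (rev x)).
  apply: (fp_foldl_grow (step := fun x : seq bool * (bits * bool) => Bits (x.2.2 :: unbits x.2.1))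
     (s0 := fun=> Bits [::]) (l := fun x => rev x) (P := fun=> 1)); [|fp|fp|by polyb|].
    by apply: (fp_comp (f := fun x => (x.2.2, x.2.1)) _ fp_consb); fp.
  by move=> c s a; rewrite /sz  /= addn1.
apply: fp_ext H => x; rewrite foldl_rev; by elim: x => //= b x ->.
Qed.

(** The tape shows a stack bottom first, so the machine hands over and expects reversed words; the
    function is conjugated by [rev] to compensate. *)
Lemma polytime_of_fp (f : seq bool -> seq bool) : fp f -> polytime f.
Proof.
move=> Hf.
have H : fp (fun x : bits => Bits (rev (f (rev (unbits x))))).
  apply: (fp_comp (f := fun x : bits => rev (f (rev (unbits x)))) _ fp_implode).
  apply: fp_rev; apply: (fp_comp (f := fun x : bits => rev (unbits x)) _ Hf).
  by apply: fp_rev; exact: fp_explode.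
have [p [P [[mP [c [k HP]]] Hp]]] := H.
apply: (@polytime_of_cmd f p c k) => x.
have [t Ht E] := Hp (Bits (rev x)).
exists t.
  apply: leq_trans Ht _; apply: leq_trans (HP _) _.
  by rewrite /sz  /= size_rev.
rewrite /= revK in E.
have E0 y : store0 y = st [:: y] by apply: functional_extensionality => -[|[|i]].
by rewrite !E0.
Qed.

(** * Unary clocks and the simulation of Turing machines by programs *)

Lemma fp_nseq_mul C (eC : Enc C) (m n : C -> nat) : fp (fun c => nseq (m c) tt) ->
  fp (fun c => nseq (n c) tt) -> fp (fun c => nseq (m c * n c) tt).
Proof.
move=> Hm Hn.
have H := fp_flatten (fp_map (f := fun x : C * unit => nseq (n x.1) tt) (fp_comp fp_fst Hn) Hm).
apply: fp_ext H => c /=.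
by elim: (m c) => //= k ->; rewrite mulSn nseqD.
Qed.

Lemma fp_nseq_poly c k : fp (fun x : seq bool => nseq (c * (size x).+1 ^ k) tt).
Proof.
apply: fp_nseq_mul; first exact: fp_const.
elim: k => [|k IH].
  by apply: (fp_ext (f := fun=> [:: tt])) (fp_const _).
have H : fp (fun x : seq bool => nseq (size x).+1 tt).
  apply: (fp_ext (f := fun x : seq bool => tt :: [seq tt | b <- x])).
    by move=> x /=; congr (_ :: _); elim: x => //= b x ->.
  apply: fp_cons; first exact: fp_const.
  by apply: (fp_map (f := fun x : seq bool * bool => tt)); fp.
by apply: fp_ext (fp_nseq_mul H IH) => x; rewrite expnS.
Qed.

Section TMsim.
Variable M : TM.
Notation Q := 'I_(tm_Q M).+1.
Notation G := 'I_(tm_G M).+3.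
Definition cfg := (Q * (seq G * (G * seq G)))%type.

Definition to_config (x : cfg) : config M := @Conf M x.1 x.2.1 x.2.2.1 x.2.2.2.

(** A halted configuration is a fixed point, so running past the halting time is harmless and any
    upper bound can serve as clock. *)
Definition dstep (o : option (Q * G * dir)) (x : cfg) : cfg :=
  match o with
  | None => x
  | Some (q', a, DS) => (q', (x.2.1, (a, x.2.2.2)))
  | Some (q', a, DL) => if x.2.1 is l :: ls then (q', (ls, (l, a :: x.2.2.2)))
                        else (q', ([::], (ord0, a :: x.2.2.2)))
  | Some (q', a, DR) => if x.2.2.2 is r :: rs then (q', (a :: x.2.1, (r, rs)))
                        else (q', (a :: x.2.1, (ord0, [::])))
  end.

Definition cstep (x : cfg) : cfg := dstep (tm_delta x.1 x.2.2.1) x.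

Lemma step_cstep x : step (to_config x) =
  if tm_delta x.1 x.2.2.1 is None then None else Some (to_config (cstep x)).
Proof.
rewrite /cstep /step; case: x => q [l [h r]] /=.
by case: tm_delta => [[[q' a] []]|] //=; [case: l|case: r].
Qed.

Lemma exec_cstep n x cf : exec n (to_config x) = Some cf -> cf = to_config (iter n cstep x).
Proof.
have stuck m y : tm_delta y.1 y.2.2.1 = None -> iter m cstep y = y.
  by move=> E; elim: m => //= m ->; rewrite /cstep E.
elim: n x => [|n IH] x; rewrite [exec _ _]/= step_cstep.
  by case: tm_delta => // -[].
case E: tm_delta => [o|]; last by case=> <-; rewrite stuck.
by move/IH; rewrite iterSr.
Qed.

Lemma fp_dstep o : fp (dstep o).
Proof.
case: o => [[[q a] []]|]; last exact: fp_id.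
- apply: (fp_seqcase (h := fun x : cfg => x.2.1) (f := fun x : cfg => (q, ([::], (ord0, a :: x.2.2.2))))
    (g := fun y : cfg * (G * seq G) => (q, (y.2.2, (y.2.1, a :: y.1.2.2.2))))); by fp.
- apply: (fp_seqcase (h := fun x : cfg => x.2.2.2) (f := fun x : cfg => (q, (a :: x.2.1, (ord0, [::]))))
    (g := fun y : cfg * (G * seq G) => (q, (a :: y.1.2.1, (y.2.1, y.2.2))))); by fp.
- by rewrite /dstep; fp.
Qed.

(** The transition table is an arbitrary function on a finite set; case distinctions on state and
    symbol leave a fixed transition in each case. *)
Lemma fp_cstep : fp cstep.
Proof.
apply: (fp_fincase (h := fun x : cfg => x.1) (g := fun q x => dstep (tm_delta q x.2.2.1) x)); first by fp.
move=> q; apply: (fp_fincase (h := fun x : cfg => x.2.2.1) (g := fun h x => dstep (tm_delta q h) x)).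
  by fp.
by move=> h; exact: fp_dstep.
Qed.

(** Codes of symbols all have the same length, so size depends only on the number of listed cells,
    and a step adds at most one. This is the additive growth that the fold requires. *)
Lemma sz_cstep x : sz (cstep x) <= sz x + 4 * (tm_G M).+4.
Proof.
rewrite /cstep; case: x => q [l [h r]] /=.
by case: tm_delta => [[[q' a] []]|] /=; [case: l => [|? ?]|case: r => [|? ?]| |];
  rewrite ?sz_pair ?sz_cons ?sz_nil !sz_ord; lia.
Qed.

Definition cinit (x : seq bool) : cfg :=
  if x is b :: bs then (ord0, ([::], (sym_of_bit M b, map (sym_of_bit M) bs)))
  else (ord0, ([::], (ord0, [::]))).

Lemma init_cinit x : init M x = to_config (cinit x).
Proof. by case: x. Qed.

Lemma fp_sym_of_bit C (eC : Enc C) (b : C -> bool) : fp b ->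
  fp (eB := enc_ord (tm_G M).+3) (fun c => sym_of_bit M (b c)).
Proof. by move=> H; rewrite /sym_of_bit; fp. Qed.

Lemma fp_cinit : fp cinit.
Proof.
apply: (fp_seqcase (h := fun x : seq bool => x) (f := fun x => (ord0, ([::], (ord0, [::]))) : cfg)
  (g := fun y : seq bool * (bool * seq bool) =>
     (ord0, ([::], (sym_of_bit M y.2.1, [seq sym_of_bit M b | b <- y.2.2])))  : cfg)); [by fp|by fp|].
apply: fp_pair; first by fp.
apply: fp_pair; first by fp.
apply: fp_pair; first by apply: fp_sym_of_bit; fp.
apply: (fp_map (f := fun y : (seq bool * (bool * seq bool)) * bool => sym_of_bit M y.2)); last by fp.
by apply: fp_sym_of_bit; fp.
Qed.

Definition read_step (a : G) (s : bool * seq bool) : bool * seq bool :=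
  if s.1 then s else if val a == 1 then (false, false :: s.2)
  else if val a == 2 then (false, true :: s.2) else (true, s.2).

Lemma read_bits_foldl (s : seq G) : read_bits (M := M) s = rev (foldl (fun s a => read_step a s) (false, [::]) s).2.
Proof.
have H1 acc l : (foldl (fun s a => read_step a s) (true, acc) l).2 = acc by elim: l.
have H acc l : (foldl (fun s a => read_step a s) (false, acc) l).2 = rev (read_bits (M := M) l) ++ acc.
  elim: l acc => //= a l IH acc; rewrite /read_step /=.
  by do 2 (case: ifP => _; first by rewrite IH rev_cons cat_rcons); rewrite H1.
by rewrite H cats0 revK.
Qed.

Lemma fp_read_bits C (eC : Enc C) (l : C -> seq G) : fp l ->
  fp (fun c => read_bits (M := M) (l c)).
Proof.
move=> Hl.
have H : fp (fun c => foldl (fun s a => read_step a s) (false, [::]) (l c)).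
  apply: (fp_foldl_grow (s0 := fun=> (false, [::]))
    (step := fun y : C * ((bool * seq bool) * G) => read_step y.2.2 y.2.1) (P := fun=> 10)).
  - apply: (fp_fincase (h := fun y : C * ((bool * seq bool) * G) => y.2.2) (g := fun a y => read_step a y.2.1)).
      by fp.
    move=> a; rewrite /read_step; do 2 (case: eqP => _; first by fp); by fp.
  - by fp.
  - by fp.
  - by polyb.
  - move=> c [b s] a; rewrite /read_step /=.
    by do ! (case: ifP => _); rewrite !sz_pair ?sz_cons !sz_bool; lia.
apply: fp_ext (fp_rev (fp_proj2 H)) => c; by rewrite read_bits_foldl.
Qed.

End TMsim.

(** This makes reductions that are known only through a machine available for composition. *)
Lemma fp_of_polytime (f : seq bool -> seq bool) : polytime f -> fp f.
Proof.
move=> [M [c [k H]]].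
have H1 : fp (fun x : seq bool => foldl (fun s _ => cstep s) (cinit M x) (nseq (c * (size x).+1 ^ k) tt)).
  apply: (fp_foldl_grow (s0 := @cinit M) (step := fun y : seq bool * (cfg M * unit) => cstep y.2.1)
    (P := fun=> 4 * (tm_G M).+4) _ (fp_cinit M) (fp_nseq_poly c k)).
  - by apply: (fp_comp (f := fun y : seq bool * (cfg M * unit) => y.2.1) _ (fp_cstep M)); fp.
  - by polyb.
  - by move=> x s a; exact: sz_cstep.
have H2 := fp_read_bits (fp_cons (fp_proj1 (fp_proj2 (fp_proj2 H1))) (fp_proj2 (fp_proj2 (fp_proj2 H1)))).
apply: fp_ext H2 => x.
have [cf [E <-]] := H x; rewrite init_cinit in E; rewrite (exec_cstep E) /output /=.
suff -> : forall n (s : cfg M), foldl (fun s _ => cstep s) s (nseq n tt) = iter n (@cstep M) s by [].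
by elim=> //= n IH s; rewrite IH -iterSr.
Qed.

(** * Arithmetic on binary numbers, least significant bit first *)

Section Fin.
Context {A B : Type} {eA : Enc A} {eB : Enc B}.

Lemma fp_bool2 (h : bool -> bool -> B) (f g : A -> bool) : fp f -> fp g ->
  fp (fun a => h (f a) (g a)).
Proof.
move=> Hf Hg; apply: (fp_fincase (g := fun b a => h b (g a)) Hf) => b.
by apply: (fp_fincase (g := fun b' _ => h b b') Hg) => b'; exact: fp_const.
Qed.

Lemma fp_head (d : B) (l : A -> seq B) : fp l -> fp (fun a => head d (l a)).
Proof.
move=> H; apply: fp_ext (fp_seqcase (f := fun=> d) (g := fun y : A * (B * seq B) => y.2.1) H _ _).
- by move=> a; case: (l a).
- by fp.
- by fp.
Qed.

Lemma fp_behead (l : A -> seq B) : fp l -> fp (fun a => behead (l a)).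
Proof.
move=> H; apply: fp_ext (fp_seqcase (f := fun=> [::]) (g := fun y : A * (B * seq B) => y.2.2) H _ _).
- by move=> a; case: (l a).
- by fp.
- by fp.
Qed.

End Fin.

Ltac fp_user ::=
  lazymatch goal with
  | |- fp (fun x => @?f x ++ @?g x) => apply: (fp_cat (l := f) (r := g))
  | |- fp (fun x => rev (@?f x)) => apply: (fp_rev (l := f))
  | |- fp (fun x => flatten (@?f x)) => apply: (fp_flatten (l := f))
  | |- fp (fun x => head ?d (@?f x)) => apply: (fp_head (l := f) d)
  | |- fp (fun x => behead (@?f x)) => apply: (fp_behead (l := f))
  end.

Definition bval (l : seq bool) : nat := foldr (fun (b : bool) v => b + v.*2) 0 l.

Lemma bval_cat l r : bval (l ++ r) = bval l + 2 ^ size l * bval r.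
Proof. by elim: l => [|b l IH] /=; rewrite ?mul1n // IH expnS; lia. Qed.

Lemma bval_behead l : bval l = head false l + (bval (behead l)).*2.
Proof. by case: l. Qed.

Lemma sz_boolseq (l : seq bool) : sz l = 6 * size l.
Proof. by elim: l => //= b l IH; rewrite sz_cons IH sz_bool; lia. Qed.

Definition add_step (s : seq bool * (seq bool * (bool * seq bool))) :=
  let x := head false s.1 in let y := head false s.2.1 in let c := s.2.2.1 in
  (behead s.1, (behead s.2.1, (if x then y || c else y && c, (x (+) y (+) c) :: s.2.2.2))).

(** The list [x ++ y] only serves as a counter, long enough to exhaust both operands; an exhausted
    operand supplies zeros. Numerals are not normalised, only their values matter. *)
Definition badd (x y : seq bool) : seq bool :=
  let s := foldl (fun s _ => add_step s) (x, (y, (false, [::]))) (x ++ y) in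
  rev (s.2.2.1 :: s.2.2.2).

Lemma fp_badd C (eC : Enc C) (f g : C -> seq bool) : fp f -> fp g -> fp (fun c => badd (f c) (g c)).
Proof.
move=> Hf Hg.
have H : fp (fun c => foldl (fun s _ => add_step s) (f c, (g c, (false, [::]))) (f c ++ g c)).
  apply: (fp_foldl_grow
    (step := fun y : C * ((seq bool * (seq bool * (bool * seq bool))) * bool) => add_step y.2.1)
    (s0 := fun c => (f c, (g c, (false, [::])))) (P := fun=> 6)).
  - rewrite /add_step; fp.
    + apply: (fp_bool2 (fun y c => y || c)); fp.
    + apply: (fp_bool2 (fun y c => y && c)); fp.
    + apply: (fp_bool2 (fun y c => y (+) c)); fp.
      by apply: (fp_bool2 (fun y c => y (+) c)); fp.
  - by fp.
  - by fp.
  - by polyb.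
  - move=> c [x [y [d o]]] b; rewrite /add_step /= !sz_pair !sz_boolseq !sz_bool /= !size_behead.
    by lia.
by rewrite /badd; fp.
Qed.

Lemma bval_badd x y : bval (badd x y) = bval x + bval y.
Proof.
rewrite /badd.
(* Invariant: value emitted so far plus 2^|o| times what remains to be added, carry included. *)
have H (l : seq bool) a b c o : size a <= size l -> size b <= size l ->
    let s := foldl (fun s (_ : bool) => add_step s) (a, (b, (c, o))) l in
    bval (rev (s.2.2.1 :: s.2.2.2)) = bval (rev o) + 2 ^ size o * (bval a + bval b + c).
  elim: l a b c o => [|e l IH] a b c o /=.
    case: a b => [|? ?] [|? ?] //= _ _.
    by rewrite rev_cons -cats1 bval_cat size_rev /=; lia.
  move=> Ha Hb; rewrite {}IH ?size_behead /=; [|by lia|by lia].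
  rewrite rev_cons -cats1 bval_cat size_rev /= expnS (bval_behead a) (bval_behead b).
  case: (head false a) (head false b) c => [] [] [] /=; lia.
by rewrite H ?size_cat ?leq_addr ?leq_addl //= mul1n addn0.
Qed.

Lemma size_badd x y : size (badd x y) = (size x + size y).+1.
Proof.
rewrite /badd size_rev /= -size_cat.
have H (l : seq bool) s : size (foldl (fun s (_ : bool) => add_step s) s l).2.2.2 = size l + size s.2.2.2.
  by elim: l s => //= e l IH s; rewrite IH /=; lia.
by rewrite H /= addn0.
Qed.

(** The least significant digit comes first, so a later difference overrides an earlier one. *)
Definition lt_step (s : seq bool * (seq bool * bool)) :=
  let x := head false s.1 in let y := head false s.2.1 in
  (behead s.1, (behead s.2.1, if x == y then s.2.2 else y)).

Definition blt (x y : seq bool) : bool :=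
  (foldl (fun s _ => lt_step s) (x, (y, false)) (x ++ y)).2.2.

Lemma fp_blt C (eC : Enc C) (f g : C -> seq bool) : fp f -> fp g -> fp (fun c => blt (f c) (g c)).
Proof.
move=> Hf Hg.
have H : fp (fun c => foldl (fun s _ => lt_step s) (f c, (g c, false)) (f c ++ g c)).
  apply: (fp_foldl_grow
    (step := fun y : C * ((seq bool * (seq bool * bool)) * bool) => lt_step y.2.1)
    (s0 := fun c => (f c, (g c, false))) (P := fun=> 0)).
  - rewrite /lt_step; fp.
    by apply: (fp_bool2 (fun y c => y == c)); fp.
  - by fp.
  - by fp.
  - by polyb.
  - by move=> c [x [y d]] b; rewrite /lt_step /= !sz_pair !sz_boolseq !sz_bool /= !size_behead; lia.
by rewrite /blt; fp.
Qed.

Lemma bltE x y : blt x y = (bval x < bval y).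
Proof.
rewrite /blt.
have H (l : seq bool) a b r : size a <= size l -> size b <= size l ->
    (foldl (fun s (_ : bool) => lt_step s) (a, (b, r)) l).2.2 =
    (bval a < bval b) || (bval a == bval b) && r.
  elim: l a b r => [|e l IH] a b r /=.
    by case: a b => [|? ?] [|? ?].
  move=> Ha Hb; rewrite {}IH ?size_behead /=; [|by lia|by lia].
  rewrite (bval_behead a) (bval_behead b).
  case: (head false a) (head false b) r => [] [] [] /=; lia.
by rewrite H ?size_cat ?leq_addr ?leq_addl //= andbF orbF.
Qed.

Ltac fp_user ::=
  lazymatch goal with
  | |- fp (fun x => @?f x ++ @?g x) => apply: (fp_cat (l := f) (r := g))
  | |- fp (fun x => rev (@?f x)) => apply: (fp_rev (l := f))
  | |- fp (fun x => flatten (@?f x)) => apply: (fp_flatten (l := f))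
  | |- fp (fun x => head ?d (@?f x)) => apply: (fp_head (l := f) d)
  | |- fp (fun x => behead (@?f x)) => apply: (fp_behead (l := f))
  | |- fp (fun x => badd (@?f x) (@?g x)) => apply: (fp_badd (f := f) (g := g))
  | |- fp (fun x => blt (@?f x) (@?g x)) => apply: (fp_blt (f := f) (g := g))
  end.

(** The length of [l] in binary and the numerals of all smaller numbers, largest first. Run along a
    formula, it supplies the indices of every block no longer than the formula. *)
Definition enumb T (l : seq T) : seq bool * seq (seq bool) :=
  foldl (fun s _ => (badd s.1 [:: true], s.1 :: s.2)) ([::], [::]) l.

(** By [size_badd] a numeral grows by 2 in every round, and the whole current numeral is added to
    the list. The growth depends on the state, so the quadratic bound is proved directly instead of
    through [fp_foldl_grow]. *)
Lemma fp_enumb T C (eT : Enc T) (eC : Enc C) (l : C -> seq T) : fp l -> fp (fun c => enumb (l c)).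
Proof.
move=> Hl; have [L [HL HL']] := fp_size Hl.
apply: (fp_foldl (step := fun y : C * ((seq bool * seq (seq bool)) * T) =>
   (badd y.2.1.1 [:: true], y.2.1.1 :: y.2.1.2)) (s0 := fun=> ([::], [::])) (l := l)
   (P := fun n => 30 * ((L n + 1) * (L n + 1)))).
- by fp.
- by fp.
- by fp.
- by polyb.
- move=> c l1 l2 E.
  have {l2 E} : size l1 <= L (sz c).
    apply: leq_trans (@size_sz _ eT l1) _; apply: leq_trans (HL' c).
    by rewrite E sz_cat leq_addr.
  move: (L (sz c)) => n Hn /=.
  rewrite -/(enumb l1).
  suff [H1 H2] : size (enumb l1).1 = 2 * size l1 /\ @sz _ (enc_seq (enc_seq enc_bool)) (enumb l1).2 <= 26 * (size l1 * size l1).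
    by rewrite (surjective_pairing (enumb l1)) sz_pair sz_boolseq H1; nia.
  elim/last_ind: l1 {Hn} => [|l1 a [IH1 IH2]]; first by rewrite /enumb /= sz_nil.
  rewrite /enumb -cats1 foldl_cat -/(enumb l1) /= size_badd sz_cons sz_boolseq size_cat /=; nia.
Qed.

Lemma enumb1 T (l : seq T) : bval (enumb l).1 = size l.
Proof.
elim/last_ind: l => // l a IH.
by rewrite /enumb -cats1 foldl_cat -/(enumb l) /= bval_badd IH size_cat.
Qed.

Lemma enumb2 T (l : seq T) : [seq bval i | i <- (enumb l).2] = rev (iota 0 (size l)).
Proof.
elim/last_ind: l => // l a IH.
rewrite {1}/enumb -cats1 foldl_cat -/(enumb l) /= enumb1 IH size_cat iotaD /=.
by rewrite rev_cat.
Qed.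

(** * Encodings as words of bit pairs *)

Definition unchunk (ps : seq (bool * bool)) : seq bool := flatten [seq [:: p.1; p.2] | p <- ps].

Definition chunk_step (s : seq bool * seq (bool * bool)) (b : bool) :=
  if s.1 is x :: _ then ([::], (x, b) :: s.2) else ([:: b], s.2).

(** This parser and the following ones are total. What they return on words that are not encodings
    is irrelevant, since such words carry no promise. *)
Definition chunk (x : seq bool) : seq (bool * bool) :=
  rev (foldl (fun s b => chunk_step s b) ([::], [::]) x).2.

Lemma chunkK ps : chunk (unchunk ps) = ps.
Proof.
have H o : (foldl (fun s b => chunk_step s b) ([::], o) (unchunk ps)) = ([::], rev ps ++ o).
  by elim: ps o => //= -[a b] ps IH o; rewrite /chunk_step /= IH rev_cons cat_rcons.
by rewrite /chunk H /= cats0 revK.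
Qed.

Lemma unchunk_cat p q : unchunk (p ++ q) = unchunk p ++ unchunk q.
Proof. by rewrite /unchunk map_cat flatten_cat. Qed.

Lemma size_unchunk p : size (unchunk p) = (size p).*2.
Proof. by elim: p => //= a p ->. Qed.

Lemma fp_unchunk C (eC : Enc C) (l : C -> seq (bool * bool)) : fp l -> fp (fun c => unchunk (l c)).
Proof.
move=> H; rewrite /unchunk; fp.
by apply: (fp_map (f := fun y : C * (bool * bool) => [:: y.2.1; y.2.2])); fp.
Qed.

Lemma fp_chunk C (eC : Enc C) (l : C -> seq bool) : fp l -> fp (fun c => chunk (l c)).
Proof.
move=> Hl.
have H : fp (fun c => foldl (fun s b => chunk_step s b) ([::], [::]) (l c)).
  apply: (fp_foldl_grow
    (step := fun y : C * ((seq bool * seq (bool * bool)) * bool) => chunk_step y.2.1 y.2.2)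
    (s0 := fun=> ([::], [::])) (P := fun=> 30)).
  - apply: (fp_seqcase (h := fun y : C * ((seq bool * seq (bool * bool)) * bool) => y.2.1.1)
      (f := fun y => ([:: y.2.2], y.2.1.2))
      (g := fun z : (C * ((seq bool * seq (bool * bool)) * bool)) * (bool * seq bool) =>
         ([::], (z.2.1, z.1.2.2) :: z.1.2.1.2))); by fp.
  - by fp.
  - by fp.
  - by polyb.
  - by move=> c [[|x s] o] b; rewrite /chunk_step /= !sz_pair ?sz_cons !sz_nil ?sz_pair !sz_bool; lia.
by rewrite /chunk; fp.
Qed.

(** The reversal reconciles two conventions: numerals are least significant digit first here and
    most significant first in the encoding. *)
Definition emitnum (ds : seq bool) : seq (bool * bool) :=
  rev [seq (b, b) | b <- ds] ++ [:: (false, true)].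

Lemma fp_emitnum C (eC : Enc C) (l : C -> seq bool) : fp l -> fp (fun c => emitnum (l c)).
Proof.
move=> H; rewrite /emitnum; fp.
by apply: (fp_map (f := fun y : C * bool => (y.2, y.2))); fp.
Qed.

Definition num_step (s : bool * (seq bool * seq (bool * bool))) (p : bool * bool) :=
  if s.1 then (true, (s.2.1, p :: s.2.2))
  else if p.1 (+) p.2 then (true, s.2) else (false, (p.1 :: s.2.1, s.2.2)).

Definition getnum (ps : seq (bool * bool)) : seq bool * seq (bool * bool) :=
  let s := foldl (fun s p => num_step s p) (false, ([::], [::])) ps in (s.2.1, rev s.2.2).

Lemma getnumE ds r : getnum (emitnum ds ++ r) = (ds, r).
Proof.
rewrite /getnum /emitnum foldl_cat foldl_cat /=.
have -> o : foldl (fun s p => num_step s p) (false, ([::], o)) (rev [seq (b, b) | b <- ds]) = (false, (ds, o)).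
  by rewrite foldl_rev; elim: ds => //= b ds ->; rewrite /num_step /= addbb.
rewrite {1}/num_step /=.
have -> ds' o : foldl (fun s p => num_step s p) (true, (ds', o)) r = (true, (ds', rev r ++ o)).
  by elim: r o => //= p r IH o; rewrite /num_step /= IH rev_cons cat_rcons.
by rewrite cats0 revK.
Qed.

Lemma fp_getnum C (eC : Enc C) (l : C -> seq (bool * bool)) : fp l -> fp (fun c => getnum (l c)).
Proof.
move=> Hl.
have H : fp (fun c => foldl (fun s p => num_step s p) (false, ([::], [::])) (l c)).
  apply: (fp_foldl_grow
    (step := fun y : C * ((bool * (seq bool * seq (bool * bool))) * (bool * bool)) => num_step y.2.1 y.2.2)
    (s0 := fun=> (false, ([::], [::]))) (P := fun=> 30)).
  - rewrite /num_step; fp.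
    by apply: (fp_bool2 (addb)); fp.
  - by fp.
  - by fp.
  - by polyb.
  - move=> c [d [s o]] [x y]; rewrite /num_step /=.
    by case: d; [|case: (x (+) y)]; rewrite /= !sz_pair ?sz_cons ?sz_pair !sz_bool; lia.
by rewrite /getnum; fp.
Qed.

Fixpoint getdims (n : nat) (ps : seq (bool * bool)) : seq (seq bool) * seq (bool * bool) :=
  if n is n'.+1 then ((getnum ps).1 :: (getdims n' (getnum ps).2).1, (getdims n' (getnum ps).2).2)
  else ([::], ps).

Definition emitdims (D : seq (seq bool)) := flatten [seq emitnum d | d <- D].

Lemma getdimsE D r : getdims (size D) (emitdims D ++ r) = (D, r).
Proof.
elim: D => // d D IH.
have -> : emitdims (d :: D) ++ r = emitnum d ++ (emitdims D ++ r) by rewrite /emitdims /= -catA.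
have E n ps : getdims n.+1 ps =
  ((getnum ps).1 :: (getdims n (getnum ps).2).1, (getdims n (getnum ps).2).2) by [].
by rewrite [size _]/= E getnumE IH.
Qed.

Lemma fp_getdims n C (eC : Enc C) (l : C -> seq (bool * bool)) : fp l -> fp (fun c => getdims n (l c)).
Proof.
elim: n l => [|n IH] l H; first by rewrite /=; fp.
change (fp (fun c => ((getnum (l c)).1 :: (getdims n (getnum (l c)).2).1,
  (getdims n (getnum (l c)).2).2))).
have H1 := fp_getnum H; have H2 := IH _ (fp_proj2 H1).
by fp.
Qed.

Lemma fp_emitdims C (eC : Enc C) (l : C -> seq (seq bool)) : fp l -> fp (fun c => emitdims (l c)).
Proof.
move=> H; rewrite /emitdims; fp.
apply: (fp_map (f := fun y : C * seq bool => emitnum y.2)) => //.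
by apply: fp_emitnum; fp.
Qed.

(* A token is a connective (with no digits) or [(false, false)] with the
   binary digits of a variable. *)
Definition token := ((bool * bool) * seq bool)%type.
Definition tleaf (ds : seq bool) : token := ((false, false), ds).
Definition tnot : token := ((false, true), [::]).
Definition tand : token := ((true, false), [::]).
Definition tor : token := ((true, true), [::]).
Definition is_leaf (t : token) : bool := ~~ (t.1.1 || t.1.2).

(** Formulas are kept as token lists in prefix notation. The reductions edit these lists and never
    build a syntax tree. *)
Definition emittoks (l : seq token) : seq (bool * bool) :=
  flatten [seq (if is_leaf t then t.1 :: emitnum t.2 else [:: t.1]) | t <- l].

Definition tok_step (s : bool * (seq bool * seq token)) (p : bool * bool) :=
  if s.1 then
    if p.1 (+) p.2 then (false, ([::], tleaf s.2.1 :: s.2.2)) else (true, (p.1 :: s.2.1, s.2.2))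
  else if p.1 || p.2 then (false, ([::], (p, [::]) :: s.2.2)) else (true, ([::], s.2.2)).

Definition tokens (ps : seq (bool * bool)) : seq token :=
  rev (foldl (fun s p => tok_step s p) (false, ([::], [::])) ps).2.2.

Definition norm_tok (t : token) : bool := is_leaf t || (t.2 == [::]).

Lemma tokensE l : all norm_tok l -> tokens (emittoks l) = l.
Proof.
rewrite /tokens => Hl.
have H o : foldl (fun s p => tok_step s p) (false, ([::], o)) (emittoks l) = (false, ([::], rev l ++ o)).
  elim: l Hl o => //= -[[x y] ds] l IH /andP[Ht Hl] o.
  rewrite /emittoks /= foldl_cat -/(emittoks l); set s := foldl _ _ (if _ then _ else _).
  suff -> : s = (false, ([::], ((x, y), ds) :: o)) by rewrite IH // rev_cons cat_rcons.
  rewrite /s; case E: (is_leaf _).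
    have [-> ->] : x = false /\ y = false by move: E; rewrite /is_leaf /=; case: (x); case: (y).
    rewrite /= {1}/tok_step /= /emitnum foldl_cat.
    have -> : foldl (fun s p => tok_step s p) (true, ([::], o)) (rev [seq (b, b) | b <- ds]) = (true, (ds, o)).
      by rewrite foldl_rev; elim: (ds) => //= b ds' ->; rewrite /tok_step /= addbb.
    by [].
  move: Ht E; rewrite /norm_tok => /orP[->//|/eqP /= ->].
  by rewrite /is_leaf /tok_step /=; case: (x || y).
by rewrite H /= cats0 revK.
Qed.

Lemma fp_tokens C (eC : Enc C) (l : C -> seq (bool * bool)) : fp l -> fp (fun c => tokens (l c)).
Proof.
move=> Hl.
have H : fp (fun c => foldl (fun s p => tok_step s p) (false, ([::], [::])) (l c)).
  apply: (fp_foldl_grow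
    (step := fun y : C * ((bool * (seq bool * seq token)) * (bool * bool)) => tok_step y.2.1 y.2.2)
    (s0 := fun=> (false, ([::], [::]))) (P := fun=> 40)).
  - rewrite /tok_step /tleaf; fp.
    + by apply: (fp_bool2 (addb)); fp.
    + by apply: (fp_bool2 (orb)); fp.
  - by fp.
  - by fp.
  - by polyb.
  - move=> c [d [s o]] [x y]; rewrite /tok_step /tleaf /=.
    by case: d; [case: (x (+) y)|case: (x || y)];
      rewrite /= !sz_pair ?sz_cons ?sz_pair ?sz_nil !sz_bool; lia.
by rewrite /tokens; fp.
Qed.

Lemma fp_emittoks C (eC : Enc C) (l : C -> seq token) : fp l -> fp (fun c => emittoks (l c)).
Proof.
move=> H; rewrite /emittoks; fp.
apply: (fp_map (f := fun y : C * token => if is_leaf y.2 then y.2.1 :: emitnum y.2.2 else [:: y.2.1])) => //.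
fp.
- by apply: (fp_bool2 (fun x y => ~~ (x || y))); fp.
- by apply: fp_emitnum; fp.
Qed.

(** * The reductions *)

Definition word (D : seq (seq bool)) (l : seq token) : seq bool := unchunk (emitdims D ++ emittoks l).

Lemma fp_word C (eC : Enc C) (D : C -> seq (seq bool)) (l : C -> seq token) :
  fp D -> fp l -> fp (fun c => word (D c) (l c)).
Proof. by move=> HD Hl; apply/fp_unchunk/fp_cat; [apply: fp_emitdims|apply: fp_emittoks]. Qed.

Lemma word_neq0 D t l : word D (t :: l) != [::].
Proof.
rewrite -size_eq0 /word size_unchunk size_cat /emittoks /=.
by case: is_leaf => /=; rewrite ?size_cat /=; lia.
Qed.

(** In prefix notation both x_1 /\ f and x_1 \/ ~f arise by putting fixed tokens in front of f. The
    empty numeral denotes variable 0, that is x_1. *)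
Definition insert (w : seq token) (n : nat) (x : seq bool) : seq bool :=
  word (getdims n (chunk x)).1 (w ++ tokens (getdims n (chunk x)).2).

Lemma fp_insert w n : fp (insert w n).
Proof.
have H : fp (fun x : seq bool => getdims n (chunk x)) by apply/fp_getdims/fp_chunk; fp.
apply: fp_word; first exact: (fp_proj1 H).
apply: fp_cat; first exact: fp_const.
by apply: fp_tokens; exact: (fp_proj2 H).
Qed.

(** The recursion is on the level [n], a constant of the problem, so that nested case distinctions
    compute it. *)
Fixpoint zipn A B (n : nat) (l : seq A) (r : seq B) : seq (A * B) :=
  if n is n'.+1 then
    if l is a :: l' then if r is b :: r' then (a, b) :: zipn n' l' r' else [::] else [::]
  else [::].

Lemma zipnE A B (l : seq A) (r : seq B) : size l = size r -> zipn (size l) l r = zip l r.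
Proof. by elim: l r => [|a l IH] [|b r] //= [/IH ->]. Qed.

Lemma fp_zipn0 A B (eA : Enc A) (eB : Enc B) n : fp (fun z : seq A * seq B => zipn n z.1 z.2).
Proof.
elim: n => [|n IH]; first exact: fp_const.
pose X := (seq A * seq B)%type; pose Y := (X * (A * seq A))%type.
apply: (fp_seqcase (h := fun z : X => z.1) (f := fun=> [::])
  (g := fun y : Y => if y.1.2 is b :: r' then (y.2.1, b) :: zipn n y.2.2 r' else [::])).
- by fp.
- by fp.
apply: (fp_seqcase (h := fun y : Y => y.1.2) (f := fun=> [::])
  (g := fun w : Y * (B * seq B) => (w.1.2.1, w.2.1) :: zipn n w.1.2.2 w.2.2)).
- by fp.
- by fp.
apply: fp_cons; first by fp.
by apply: (fp_comp (f := fun w : Y * (B * seq B) => (w.1.2.2, w.2.2)) _ IH); fp.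
Qed.

Lemma fp_zipn A B C (eA : Enc A) (eB : Enc B) (eC : Enc C) n (l : C -> seq A) (r : C -> seq B) :
  fp l -> fp r -> fp (fun c => zipn n (l c) (r c)).
Proof. by move=> Hl Hr; exact: (fp_comp (fp_pair Hl Hr) (fp_zipn0 _ _ n)). Qed.

Notation dimpairs := (seq (seq bool * seq bool)).

(** A merged block is an f-part followed by a g-part, and the selector b precedes everything. A
    variable of f thus moves up by 1 plus the lengths of the g-parts of all earlier blocks: a g-part
    counts once the index lies beyond the end of the f-part of that block. *)
Definition remapf (Z : dimpairs) (i : seq bool) : seq bool :=
  (foldl (fun s ab => (badd s.1 ab.1, if blt i (badd s.1 ab.1) then s.2 else badd s.2 ab.2))
    ([::], badd i [:: true]) Z).2.

(** A variable of g also jumps over the f-part of its own block, hence the comparison with the start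
    of the block instead of its end. *)
Definition remapg (Z : dimpairs) (i : seq bool) : seq bool :=
  (foldl (fun s ab => (badd s.1 ab.2, if blt i s.1 then s.2 else badd s.2 ab.1))
    ([::], badd i [:: true]) Z).2.

Lemma fp_remapf : fp (fun c : dimpairs * seq bool => remapf c.1 c.2).
Proof.
apply: (fp_proj2 (f := fun c : dimpairs * seq bool =>
  foldl (fun s ab => (badd s.1 ab.1, if blt c.2 (badd s.1 ab.1) then s.2 else badd s.2 ab.2))
    ([::], badd c.2 [:: true]) c.1)).
pose T := ((dimpairs * seq bool) * ((seq bool * seq bool) * (seq bool * seq bool)))%type.
apply: (fp_foldl_grow (step := fun y : T => (badd y.2.1.1 y.2.2.1,
    if blt y.1.2 (badd y.2.1.1 y.2.2.1) then y.2.1.2 else badd y.2.1.2 y.2.2.2))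
    (s0 := fun c : dimpairs * seq bool => ([::], badd c.2 [:: true]))
    (P := fun n => 30 * (n + 1))).
- by fp.
- by fp.
- by fp.
- by polyb.
- move=> [Z i] [A acc] [a b] /=.
  by case: ifP => _; rewrite !sz_pair !sz_boolseq !size_badd; lia.
Qed.

Lemma fp_remapg : fp (fun c : dimpairs * seq bool => remapg c.1 c.2).
Proof.
apply: (fp_proj2 (f := fun c : dimpairs * seq bool =>
  foldl (fun s ab => (badd s.1 ab.2, if blt c.2 s.1 then s.2 else badd s.2 ab.1))
    ([::], badd c.2 [:: true]) c.1)).
pose T := ((dimpairs * seq bool) * ((seq bool * seq bool) * (seq bool * seq bool)))%type.
apply: (fp_foldl_grow (step := fun y : T => (badd y.2.1.1 y.2.2.2,
    if blt y.1.2 y.2.1.1 then y.2.1.2 else badd y.2.1.2 y.2.2.1))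
    (s0 := fun c : dimpairs * seq bool => ([::], badd c.2 [:: true]))
    (P := fun n => 30 * (n + 1))).
- by fp.
- by fp.
- by fp.
- by polyb.
- move=> [Z i] [A acc] [a b] /=.
  by case: ifP => _; rewrite !sz_pair !sz_boolseq !size_badd; lia.
Qed.

Definition retok (R : seq bool -> seq bool) (l : seq token) : seq token :=
  [seq if is_leaf t then (t.1, R t.2) else t | t <- l].

Lemma fp_is_leaf C (eC : Enc C) (t : C -> token) : fp t -> fp (fun c => is_leaf (t c)).
Proof. by move=> H; apply: (fp_bool2 (fun x y => ~~ (x || y))); fp. Qed.

Lemma fp_retok C (eC : Enc C) (R : dimpairs -> seq bool -> seq bool) (Z : C -> dimpairs)
    (l : C -> seq token) :
  fp (fun c : dimpairs * seq bool => R c.1 c.2) -> fp Z -> fp l ->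
  fp (fun c => retok (R (Z c)) (l c)).
Proof.
move=> HR HZ Hl.
have HZ1 : fp (fun y : C * token => Z y.1) := fp_comp fp_fst HZ.
apply: (fp_map (f := fun y : C * token => if is_leaf y.2 then (y.2.1, R (Z y.1) y.2.2) else y.2)) => //.
fp; first by apply: fp_is_leaf; fp.
by apply: (fp_comp (f := fun y : C * token => (Z y.1, y.2.2)) _ HR); fp.
Qed.

(** An unfinished prefix expression: each conjunction leaves its second argument open, to be filled
    by the tokens that follow. *)
Definition pad (off a : seq bool) (E : seq (seq bool)) : seq token :=
  flatten [seq if blt i a then [:: tand; tnot; tleaf (badd off i)] else [::] | i <- E].

Lemma fp_pad C (eC : Enc C) (off a : C -> seq bool) (E : C -> seq (seq bool)) :
  fp off -> fp a -> fp E -> fp (fun c => pad (off c) (a c) (E c)).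
Proof.
move=> Ho Ha HE; apply: fp_flatten.
have Ho1 : fp (fun y : C * seq bool => off y.1) := fp_comp fp_fst Ho.
have Ha1 : fp (fun y : C * seq bool => a y.1) := fp_comp fp_fst Ha.
apply: (fp_map (f := fun y : C * seq bool =>
  if blt y.2 (a y.1) then [:: tand; tnot; tleaf (badd (off y.1) y.2)] else [::])) => //.
by rewrite /tleaf; fp.
Qed.

Definition merged_dims (Z : dimpairs) : seq (seq bool) :=
  if Z is ab :: Z' then
    badd (badd ab.1 ab.2) [:: true] :: [seq badd p.1 p.2 | p <- Z'] else [::].

Lemma fp_merged_dims : fp merged_dims.
Proof.
pose T := (dimpairs * ((seq bool * seq bool) * dimpairs))%type.
apply: (fp_seqcase (h := fun Z : dimpairs => Z) (f := fun=> [::])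
  (g := fun y : T => badd (badd y.2.1.1 y.2.1.2) [:: true] :: [seq badd p.1 p.2 | p <- y.2.2])).
- by fp.
- by fp.
- apply: fp_cons; first by fp.
  by apply: (fp_map (f := fun z : T * (seq bool * seq bool) => badd z.2.1 z.2.2)); fp.
Qed.

(* The two lists of dimensions and formulas are those of instances [f] of USAT and [g] of coUSAT;
   the tokens are those of (b /\ w = 0 /\ f(z)) \/ (~b /\ z = 0 /\ ~g(w)). *)
Definition merged_tokens (Z : dimpairs) (a b : seq bool) (F G : seq token)
    (E1 E2 : seq (seq bool)) : seq token :=
  [:: tor, tand, tleaf [::] & pad (badd a [:: true]) b E2] ++ retok (remapf Z) F ++
  [:: tand, tnot, tleaf [::] & pad [:: true] a E1] ++ tnot :: retok (remapg Z) G.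

Definition parsed := (seq (seq bool) * seq (bool * bool))%type.

(** The length of a formula is measured in bit pairs. In the two exceptional cases all dimensions
    are 1 and the formula is ~x_1 or x_1, with unique solution 0 or 1. *)
Definition combine0 (n : nat) (x y : parsed) : seq bool :=
  if blt (enumb x.2).1 (head [::] x.1) then word (nseq n [:: true]) [:: tnot; tleaf [::]]
  else if blt (enumb y.2).1 (head [::] y.1) then word (nseq n [:: true]) [:: tleaf [::]]
  else word (merged_dims (zipn n x.1 y.1))
    (merged_tokens (zipn n x.1 y.1) (head [::] x.1) (head [::] y.1) (tokens x.2) (tokens y.2)
       (enumb x.2).2 (enumb y.2).2).

Lemma fp_combine0 n : fp (fun c : parsed * parsed => combine0 n c.1 c.2).
Proof.
pose T := (parsed * parsed)%type.
have Hx1 : fp (fun c : T => c.1.1) by fp.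
have Hy1 : fp (fun c : T => c.2.1) by fp.
have Hx2 : fp (fun c : T => c.1.2) by fp.
have Hy2 : fp (fun c : T => c.2.2) by fp.
have Hex := fp_enumb Hx2; have Hey := fp_enumb Hy2.
have HZ := fp_zipn n Hx1 Hy1.
apply: fp_if; first by apply: fp_blt; [exact: (fp_proj1 Hex)|fp].
  exact: fp_const.
apply: fp_if; first by apply: fp_blt; [exact: (fp_proj1 Hey)|fp].
  exact: fp_const.
apply: fp_word; first exact: (fp_comp HZ fp_merged_dims).
apply: fp_cat.
  do 3 (apply: fp_cons; first exact: fp_const).
  by apply: fp_pad; [fp|fp|exact: (fp_proj2 Hey)].
apply: fp_cat; first by apply: (fp_retok fp_remapf HZ); exact: fp_tokens.
apply: fp_cat.
  do 3 (apply: fp_cons; first exact: fp_const).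
  by apply: fp_pad; [fp|fp|exact: (fp_proj2 Hex)].
apply: fp_cons; first exact: fp_const.
by apply: (fp_retok fp_remapg HZ); exact: fp_tokens.
Qed.

Definition combine (n : nat) (u v : seq bool) : seq bool :=
  combine0 n (getdims n (chunk u)) (getdims n (chunk v)).

Lemma fp_combine n (f g : seq bool -> seq bool) : fp f -> fp g -> fp (fun x => combine n (f x) (g x)).
Proof.
move=> Hf Hg.
apply: (fp_comp (f := fun x => (getdims n (chunk (f x)), getdims n (chunk (g x)))) _ (fp_combine0 n)).
by apply: fp_pair; apply/fp_getdims/fp_chunk.
Qed.

Lemma combine_neq0 n u v : combine n u v != [::].
Proof.
rewrite /combine /combine0; case: ifP => _; first exact: word_neq0.
by case: ifP => _; exact: word_neq0.
Qed.

(** * Decoding *)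

(** A relation and not a function, because a variable has many numerals, differing in leading
    zeros. *)
Inductive ftok : form -> seq token -> Prop :=
| ftok_var ds : ftok (FVar (bval ds)) [:: tleaf ds]
| ftok_not f l : ftok f l -> ftok (FNot f) (tnot :: l)
| ftok_and f g l r : ftok f l -> ftok g r -> ftok (FAnd f g) (tand :: l ++ r)
| ftok_or f g l r : ftok f l -> ftok g r -> ftok (FOr f g) (tor :: l ++ r).

Lemma ftok_norm f l : ftok f l -> all norm_tok l.
Proof. by elim=> // *; rewrite /= all_cat; apply/andP. Qed.

Definition msb (acc : nat) (es : seq bool) : nat := foldl (fun a (b : bool) => b + a.*2) acc es.

Lemma msb_rev ds : msb 0 (rev ds) = bval ds.
Proof. by rewrite /msb foldl_rev. Qed.

Lemma dnat_msb acc es r :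
  dnat acc (unchunk ([seq (b, b) | b <- es] ++ [:: (false, true)]) ++ r) = Some (msb acc es, r).
Proof. by elim: es acc => [|[] es IH] acc //=; rewrite IH. Qed.

Lemma emitnumE ds : emitnum ds = [seq (b, b) | b <- rev ds] ++ [:: (false, true)].
Proof. by rewrite /emitnum map_rev. Qed.

Lemma dnat_emitnum ds r : dnat 0 (unchunk (emitnum ds) ++ r) = Some (bval ds, r).
Proof. by rewrite emitnumE dnat_msb msb_rev. Qed.

Lemma dnat_sound acc s v r : dnat acc s = Some (v, r) -> exists es,
  s = unchunk ([seq (b, b) | b <- es] ++ [:: (false, true)]) ++ r /\ v = msb acc es.
Proof.
have [m] := ubnP (size s); elim: m s acc => // m IH [|a [|b s]] acc //=; first by case: a.
rewrite ltnS => Hs; have {}Hs : size s < m by lia.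
case: a b => [] [] //; try by move/(IH _ _ Hs) => [es [-> ->]]; [exists (true :: es)|exists (false :: es)].
  by move/(IH _ _ Hs) => [es [-> ->]]; exists (true :: es).
- by case=> <- <-; exists [::].
- by move/(IH _ _ Hs) => [es [-> ->]]; exists (false :: es).
Qed.

Lemma dnat_sound0 s v r : dnat 0 s = Some (v, r) -> exists ds,
  s = unchunk (emitnum ds) ++ r /\ v = bval ds.
Proof.
by move/dnat_sound => [es [-> ->]]; exists (rev es); rewrite emitnumE revK -msb_rev revK.
Qed.

Lemma emittoks_cat l r : emittoks (l ++ r) = emittoks l ++ emittoks r.
Proof. by rewrite /emittoks map_cat flatten_cat. Qed.

Lemma emittoks_cons t l : emittoks (t :: l) = (if is_leaf t then t.1 :: emitnum t.2 else [:: t.1]) ++ emittoks l.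
Proof. by []. Qed.

Lemma size_emittoks l : size l <= size (emittoks l).
Proof. by elim: l => // t l IH; rewrite emittoks_cons size_cat; case: ifP => _ /=; lia. Qed.

Lemma dform_complete f l fuel r : ftok f l -> size l <= fuel ->
  dform fuel (unchunk (emittoks l) ++ r) = Some (f, r).
Proof.
move=> H; elim: H fuel r => {f l}.
- move=> ds [//|fuel] r _.
  rewrite emittoks_cons cats0 /=.
  by rewrite -/(unchunk _) dnat_emitnum.
- by move=> f l _ IH [//|fuel] r /= Hs; rewrite -/(emittoks l) -/(unchunk _) IH.
- move=> f g l1 l2 _ IH1 _ IH2 [//|fuel] r /=; rewrite size_cat => Hs.
  rewrite -/(emittoks _) -/(unchunk _) emittoks_cat unchunk_cat -catA.
  by rewrite IH1 ?IH2 //; lia.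
- move=> f g l1 l2 _ IH1 _ IH2 [//|fuel] r /=; rewrite size_cat => Hs.
  rewrite -/(emittoks _) -/(unchunk _) emittoks_cat unchunk_cat -catA.
  by rewrite IH1 ?IH2 //; lia.
Qed.

Lemma dform_sound fuel s f r : dform fuel s = Some (f, r) -> exists l,
  s = unchunk (emittoks l) ++ r /\ ftok f l.
Proof.
elim: fuel s f r => //= fuel IH [|a [|b s]] f r //=; first by case: a.
case: a b => [] [].
- case E1: dform => [[g r1]|//]; case E2: dform => [[h r2]|//] [<- <-].
  have [l1 [-> H1]] := IH _ _ _ E1; have [l2 [-> H2]] := IH _ _ _ E2.
  exists (tor :: l1 ++ l2); split; last exact: ftok_or.
  by rewrite emittoks_cons emittoks_cat /= -/(unchunk _) unchunk_cat -catA.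
- case E1: dform => [[g r1]|//]; case E2: dform => [[h r2]|//] [<- <-].
  have [l1 [-> H1]] := IH _ _ _ E1; have [l2 [-> H2]] := IH _ _ _ E2.
  exists (tand :: l1 ++ l2); split; last exact: ftok_and.
  by rewrite emittoks_cons emittoks_cat /= -/(unchunk _) unchunk_cat -catA.
- case E1: dform => [[g r1]|//] [<- <-]; have [l1 [-> H1]] := IH _ _ _ E1.
  by exists (tnot :: l1); split; last exact: ftok_not.
- case E1: dnat => [[g r1]|//] [<- <-]; have [ds [-> ->]] := dnat_sound0 E1.
  exists [:: tleaf ds]; split; last exact: ftok_var.
  by rewrite emittoks_cons cats0.
Qed.

Lemma ddims_complete D r : ddims (size D) (unchunk (emitdims D) ++ r) = Some (map bval D, r).
Proof.
elim: D => //= d D IH.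
by rewrite /emitdims /= -/(emitdims D) unchunk_cat -catA dnat_emitnum IH.
Qed.

Lemma ddims_sound n s ms r : ddims n s = Some (ms, r) -> exists D,
  [/\ size D = n, s = unchunk (emitdims D) ++ r & ms = map bval D].
Proof.
elim: n s ms r => [|n IH] s ms r /=; first by case=> <- <-; exists [::].
case E1: dnat => [[m r1]|//]; case E2: ddims => [[ms' r2]|//] [<- <-].
have [d [-> ->]] := dnat_sound0 E1; have [D [<- -> ->]] := IH _ _ _ E2.
exists (d :: D); split => //.
by rewrite /emitdims /= -/(emitdims D) unchunk_cat -catA.
Qed.

Definition wf_inst (ms : seq nat) (f : form) : bool :=
  all (fun m => 0 < m) ms && fwf (sumn ms) f.

Lemma decode_word D f l : ftok f l -> wf_inst (map bval D) f ->
  decode (size D) (word D l) = Some (map bval D, f).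
Proof.
move=> Hf Hwf; rewrite /decode /word unchunk_cat ddims_complete.
have Hs : size l <= size (unchunk (emittoks l)).
  by rewrite size_unchunk; have := size_emittoks l; lia.
by have := dform_complete [::] Hf Hs; rewrite cats0 => ->; rewrite -/(wf_inst _ _) Hwf.
Qed.

Lemma decode_sound n x ms f : decode n x = Some (ms, f) -> exists D l,
  [/\ size D = n, x = word D l, ms = map bval D, ftok f l & wf_inst ms f].
Proof.
rewrite /decode; case E1: ddims => [[ms' r]|//].
case E2: dform => [[f' [|//]]|//]; case: ifP => // Hwf [<- <-].
have [D [HD -> HM]] := ddims_sound E1; have [l [-> Hl]] := dform_sound E2.
exists D, l; split => //.
by rewrite cats0 /word unchunk_cat.
Qed.

Lemma getdims_word D l : getdims (size D) (chunk (word D l)) = (D, emittoks l).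
Proof. by rewrite /word chunkK getdimsE. Qed.

(** * Quantified evaluation of arbitrary predicates *)

(** This is [qsat] with an arbitrary predicate as matrix, so that assignments of different shapes
    can be compared without exhibiting formulas. *)
Fixpoint qeval (e : bool) (ms : seq nat) (pre : seq bool) (P : seq bool -> bool) : bool :=
  match ms with
  | [::] => P pre
  | m :: ms' =>
    if e then [exists y : m.-tuple bool, qeval false ms' (pre ++ val y) P]
    else [forall y : m.-tuple bool, qeval true ms' (pre ++ val y) P]
  end.

Lemma qsatE e ms pre f : qsat e ms pre f = qeval e ms pre (feval f).
Proof.
elim: ms e pre => //= m ms IH [] pre.
  by apply: eq_existsb => y; rewrite IH.
by apply: eq_forallb => y; rewrite IH.
Qed.

Lemma qeval_ext e ms pre pre' P Q :
  (forall z, size z = sumn ms -> P (pre ++ z) = Q (pre' ++ z)) ->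
  qeval e ms pre P = qeval e ms pre' Q.
Proof.
elim: ms e pre pre' => [|m ms IH] e pre pre' H /=.
  by have := H [::] erefl; rewrite !cats0.
have H' (y : m.-tuple bool) e' : qeval e' ms (pre ++ y) P = qeval e' ms (pre' ++ y) Q.
  by apply: IH => z Hz; rewrite -!catA; apply: H; rewrite size_cat size_tuple /= Hz.
by case: e; [apply: eq_existsb|apply: eq_forallb] => y; rewrite H'.
Qed.

Lemma qeval_neg e ms pre P : qeval e ms pre (fun z => ~~ P z) = ~~ qeval (~~ e) ms pre P.
Proof.
elim: ms e pre => //= m ms IH [] pre /=.
  by rewrite negb_forall; apply: eq_existsb => y; rewrite IH.
by rewrite negb_exists; apply: eq_forallb => y; rewrite IH.
Qed.

Lemma qeval_const e ms pre c : qeval e ms pre (fun=> c) = c.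
Proof.
elim: ms e pre => //= m ms IH [] pre /=.
  by apply/existsP/idP => [[y]|Hc]; [rewrite IH|exists (nseq_tuple m true); rewrite IH].
by apply/forallP/idP => [/(_ (nseq_tuple m true))|Hc y]; rewrite IH.
Qed.

(* The blocks of an assignment for dimensions [a + b] split in an [a]-part and a [b]-part. *)
Fixpoint projA (L : seq (nat * nat)) (z : seq bool) : seq bool :=
  if L is (a, b) :: L' then take a z ++ projA L' (drop (a + b) z) else [::].

Fixpoint projB (L : seq (nat * nat)) (z : seq bool) : seq bool :=
  if L is (a, b) :: L' then take b (drop a z) ++ projB L' (drop (a + b) z) else [::].

Definition sums (L : seq (nat * nat)) : seq nat := [seq p.1 + p.2 | p <- L].

Lemma exists_tuple m (P : seq bool -> bool) :
  [exists y : m.-tuple bool, P y] <-> exists2 w, size w = m & P w.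
Proof.
split=> [/existsP[y Hy]|[w /eqP Hw HP]]; first by exists (val y); rewrite ?size_tuple.
by apply/existsP; exists (Tuple Hw).
Qed.

Lemma forall_tuple m (P : seq bool -> bool) :
  [forall y : m.-tuple bool, P y] <-> forall w, size w = m -> P w.
Proof.
split=> [/forallP H w /eqP Hw|H]; first exact: (H (Tuple Hw)).
by apply/forallP => y; apply: H; rewrite size_tuple.
Qed.

(** The second parts of the blocks do not influence the value. A witness for a merged block is
    truncated to its first part; conversely a first part is extended by zeros. *)
Lemma qeval_projA e L pre preA P Q :
  (forall z, size z = sumn (sums L) -> P (pre ++ z) = Q (preA ++ projA L z)) ->
  qeval e (sums L) pre P = qeval e (unzip1 L) preA Q.
Proof.
elim: L e pre preA => [|[a b] L IH] e pre preA H /=.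
  by have := H [::] erefl; rewrite !cats0.
have H' e' w : size w = a + b ->
    qeval e' (sums L) (pre ++ w) P = qeval e' (unzip1 L) (preA ++ take a w) Q.
  move=> Hw; apply: IH => z Hz; rewrite -!catA H /=; last by rewrite size_cat Hw Hz.
  rewrite take_cat drop_cat Hw ltnn subnn drop0.
  (* The remaining case is b = 0, where the cut falls at the end of [w]. *)
  by case: ltnP => // ?; rewrite (_ : a - (a + b) = 0) ?take0 ?cats0 ?take_oversize //; lia.
case: e; apply/idP/idP.
- case/(exists_tuple _ (fun y => qeval _ _ (pre ++ y) P)) => w Hw; rewrite H' // => HQ.
  apply/(exists_tuple _ (fun y => qeval _ _ (preA ++ y) Q)); exists (take a w) => //.
  by rewrite size_take Hw; case: ltnP; lia.
- case/(exists_tuple _ (fun y => qeval _ _ (preA ++ y) Q)) => w Hw HQ.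
  apply/(exists_tuple _ (fun y => qeval _ _ (pre ++ y) P)); exists (w ++ nseq b false).
    by rewrite size_cat Hw size_nseq.
  by rewrite H' ?size_cat ?Hw ?size_nseq // take_size_cat.
- move/(forall_tuple _ (fun y => qeval _ _ (pre ++ y) P)) => HP.
  apply/(forall_tuple _ (fun y => qeval _ _ (preA ++ y) Q)) => w Hw.
  have := HP (w ++ nseq b false); rewrite size_cat Hw size_nseq => /(_ erefl).
  by rewrite H' ?size_cat ?Hw ?size_nseq // take_size_cat.
- move/(forall_tuple _ (fun y => qeval _ _ (preA ++ y) Q)) => HQ.
  apply/(forall_tuple _ (fun y => qeval _ _ (pre ++ y) P)) => w Hw.
  by rewrite H' //; apply: HQ; rewrite size_take Hw; case: ltnP; lia.
Qed.

Lemma qeval_projB e L pre preB P Q :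
  (forall z, size z = sumn (sums L) -> P (pre ++ z) = Q (preB ++ projB L z)) ->
  qeval e (sums L) pre P = qeval e (unzip2 L) preB Q.
Proof.
elim: L e pre preB => [|[a b] L IH] e pre preB H /=.
  by have := H [::] erefl; rewrite !cats0.
have H' e' w : size w = a + b ->
    qeval e' (sums L) (pre ++ w) P = qeval e' (unzip2 L) (preB ++ drop a w) Q.
  move=> Hw; apply: IH => z Hz; rewrite -!catA H /=; last by rewrite size_cat Hw Hz.
  rewrite !drop_cat Hw ltnn subnn drop0.
  case: ltnP => Ha.
    by rewrite take_size_cat // size_drop Hw addKn.
  have b0 : b = 0 by lia.
  by rewrite b0 take0 drop_oversize // Hw b0 addn0.
case: e; apply/idP/idP.
- case/(exists_tuple _ (fun y => qeval _ _ (pre ++ y) P)) => w Hw; rewrite H' // => HQ.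
  apply/(exists_tuple _ (fun y => qeval _ _ (preB ++ y) Q)); exists (drop a w) => //.
  by rewrite size_drop Hw addKn.
- case/(exists_tuple _ (fun y => qeval _ _ (preB ++ y) Q)) => w Hw HQ.
  apply/(exists_tuple _ (fun y => qeval _ _ (pre ++ y) P)); exists (nseq a false ++ w).
    by rewrite size_cat Hw size_nseq.
  by rewrite H' ?size_cat ?Hw ?size_nseq // drop_size_cat ?size_nseq.
- move/(forall_tuple _ (fun y => qeval _ _ (pre ++ y) P)) => HP.
  apply/(forall_tuple _ (fun y => qeval _ _ (preB ++ y) Q)) => w Hw.
  have := HP (nseq a false ++ w); rewrite size_cat Hw size_nseq => /(_ erefl).
  by rewrite H' ?size_cat ?Hw ?size_nseq // drop_size_cat ?size_nseq.
- move/(forall_tuple _ (fun y => qeval _ _ (preB ++ y) Q)) => HQ.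
  apply/(forall_tuple _ (fun y => qeval _ _ (pre ++ y) P)) => w Hw.
  by rewrite H' //; apply: HQ; rewrite size_drop Hw addKn.
Qed.

(** * Renaming of variables *)

Fixpoint fren (r : nat -> nat) (f : form) : form :=
  match f with
  | FVar i => FVar (r i)
  | FNot g => FNot (fren r g)
  | FAnd g h => FAnd (fren r g) (fren r h)
  | FOr g h => FOr (fren r g) (fren r h)
  end.

Lemma feval_fren r f k z w : fwf k f -> (forall i, i < k -> nth false z (r i) = nth false w i) ->
  feval (fren r f) z = feval f w.
Proof.
move=> Hf H; elim: f Hf => [i|f IH|f IHf g IHg|f IHf g IHg] /=; first exact: H.
- by move/IH ->.
- by case/andP => /IHf -> /IHg ->.
- by case/andP => /IHf -> /IHg ->.
Qed.

Lemma fwf_fren r f k k' : fwf k f -> (forall i, i < k -> r i < k') -> fwf k' (fren r f).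
Proof.
move=> Hf H; elim: f Hf => [i|//|f IHf g IHg|f IHf g IHg] /=; first exact: H.
- by case/andP => /IHf -> /IHg ->.
- by case/andP => /IHf -> /IHg ->.
Qed.

Lemma ftok_fren R r f l : (forall ds, bval (R ds) = r (bval ds)) -> ftok f l ->
  ftok (fren r f) (retok R l).
Proof.
move=> H; elim=> {f l} /=.
- by move=> ds; rewrite -H; exact: ftok_var.
- by move=> f l _ IH; exact: ftok_not.
- by move=> f g l1 l2 _ IH1 _ IH2; rewrite /retok map_cat; exact: ftok_and.
- by move=> f g l1 l2 _ IH1 _ IH2; rewrite /retok map_cat; exact: ftok_or.
Qed.

(** The displacement of a variable, by recursion on the blocks and without digits or accumulators:
    the specification against which [remapf] is verified, as [shiftB] is for [remapg]. *)
Fixpoint shiftA (L : seq (nat * nat)) (i : nat) : nat :=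
  if L is (a, b) :: L' then if i < a then 0 else b + shiftA L' (i - a) else 0.

Fixpoint shiftB (L : seq (nat * nat)) (i : nat) : nat :=
  if L is (a, b) :: L' then a + (if i < b then 0 else shiftB L' (i - b)) else 0.

Definition vals (Z : dimpairs) : seq (nat * nat) := [seq (bval p.1, bval p.2) | p <- Z].

Lemma bval_remapf Z i : bval (remapf Z i) = (bval i + shiftA (vals Z) (bval i)).+1.
Proof.
rewrite /remapf; set F := fun s ab => _.
(* [A] counts the f-variables in the blocks already passed. Once it exceeds the index, the block of
   the variable lies behind and nothing more is added. *)
have H A acc : bval (foldl F (A, acc) Z).2 =
    bval acc + (if bval A <= bval i then shiftA (vals Z) (bval i - bval A) else 0).
  elim: Z A acc => [|[a b] Z IH] A acc /=; first by case: ifP; rewrite addn0.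
  rewrite IH /= bltE bval_badd subnDA.
  case: (ltnP (bval i) (bval A + bval a)) => Hi.
    by case: (leqP (bval A) (bval i)) => // HA; rewrite ifT //; lia.
  rewrite bval_badd (leq_trans (leq_addr _ _) Hi) ifF; last by apply/negbTE; lia.
  by lia.
by rewrite H /= subn0 bval_badd /=; lia.
Qed.

Lemma bval_remapg Z i : bval (remapg Z i) = (bval i + shiftB (vals Z) (bval i)).+1.
Proof.
rewrite /remapg; set F := fun s ab => _.
have H A acc : bval (foldl F (A, acc) Z).2 =
    bval acc + (if bval A <= bval i then shiftB (vals Z) (bval i - bval A) else 0).
  elim: Z A acc => [|[a b] Z IH] A acc /=; first by case: ifP; rewrite addn0.
  rewrite IH /= bltE bval_badd subnDA.
  case: (ltnP (bval i) (bval A)) => Hi.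
    by rewrite ifF //; apply/negbTE; lia.
  by rewrite bval_badd; case: (ltnP (bval i - bval A) (bval b)) => Hb; [rewrite ifF|rewrite ifT]; lia.
by rewrite H /= subn0 bval_badd /=; lia.
Qed.

Lemma nth_projA L z i : size z = sumn (sums L) -> i < sumn (unzip1 L) ->
  nth false z (i + shiftA L i) = nth false (projA L z) i.
Proof.
elim: L z i => [|[a b] L IH] z i //= Hz Hi.
rewrite nth_cat size_take; case: (ltnP a (size z)) => Ha.
  case: ifP => Hia; first by rewrite addn0 nth_take.
  rewrite -IH ?nth_drop; [|by rewrite size_drop; lia|by lia].
  by congr nth; lia.
have [b0 L0] : b = 0 /\ sumn (sums L) = 0 by lia.
case: ifP => Hia; case: ifP => Hiz; try lia.
  by rewrite addn0 nth_take.
have : sumn (unzip1 L) <= sumn (sums L).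
  by elim: (L) => //= p L' IHL; rewrite /sums /= in IHL *; lia.
by lia.
Qed.

Lemma nth_projB L z i : size z = sumn (sums L) -> i < sumn (unzip2 L) ->
  nth false z (i + shiftB L i) = nth false (projB L z) i.
Proof.
elim: L z i => [|[a b] L IH] z i //= Hz Hi.
have Hs : size (take b (drop a z)) = b by rewrite size_takel // size_drop; lia.
rewrite nth_cat Hs; case: ifP => Hib; first by rewrite nth_take // nth_drop addn0 addnC.
rewrite -IH ?nth_drop; [|by rewrite size_drop; lia|by lia].
by congr nth; lia.
Qed.

Lemma shiftA_lt L i : i < sumn (unzip1 L) -> i + shiftA L i < sumn (sums L).
Proof.
elim: L i => [|[a b] L IH] i //= Hi; case: ifP => Hia; first by rewrite /sums; lia.
by have := IH (i - a); lia.
Qed.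

Lemma shiftB_lt L i : i < sumn (unzip2 L) -> i + shiftB L i < sumn (sums L).
Proof.
elim: L i => [|[a b] L IH] i //= Hi; case: ifP => Hia; first by rewrite /sums; lia.
by have := IH (i - b); lia.
Qed.

Definition padform (I : seq nat) (f : form) : form :=
  foldr (fun i g => FAnd (FNot (FVar i)) g) f I.

Lemma feval_padform I f z : feval (padform I f) z = all (fun i => ~~ nth false z i) I && feval f z.
Proof. by elim: I => //= i I ->; rewrite andbA. Qed.

Lemma fwf_padform I f k : fwf k (padform I f) = all (fun i => i < k) I && fwf k f.
Proof. by elim: I => //= i I ->; rewrite andbA. Qed.

Lemma ftok_pad off a E f l : ftok f l ->
  ftok (padform [seq bval off + i | i <- [seq bval i | i <- E] & i < bval a] f) (pad off a E ++ l).
Proof.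
move=> H; rewrite /pad; elim: E => //= i E IH; rewrite bltE.
case: ifP => // _; rewrite /= -bval_badd.
exact: (ftok_and (ftok_not (ftok_var _)) IH).
Qed.

(** * Unmentioned variables *)

Fixpoint fvars (f : form) : seq nat :=
  match f with
  | FVar i => [:: i]
  | FNot g => fvars g
  | FAnd g h | FOr g h => fvars g ++ fvars h
  end.

Lemma size_fvars f l : ftok f l -> size (fvars f) <= size l.
Proof. by elim=> //= *; rewrite ?size_cat; lia. Qed.

Lemma feval_fvars f z w : {in fvars f, forall i, nth false z i = nth false w i} ->
  feval f z = feval f w.
Proof.
elim: f => //=.
- by move=> i H; apply: H; rewrite inE.
- by move=> f IH /IH ->.
- by move=> f IHf g IHg H; rewrite IHf ?IHg // => i Hi; apply: H; rewrite mem_cat Hi ?orbT.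
- by move=> f IHf g IHg H; rewrite IHf ?IHg // => i Hi; apply: H; rewrite mem_cat Hi ?orbT.
Qed.

Lemma unmentioned f m : size (fvars f) < m -> exists2 i, i < m & i \notin fvars f.
Proof.
move=> H; case E: (all (mem (fvars f)) (iota 0 m)).
  have /(leq_trans H) : m <= size (fvars f).
    by rewrite -{1}(size_iota 0 m); apply: uniq_leq_size (iota_uniq _ _) (allP E).
  by rewrite ltnn.
move/negbT: E; rewrite -has_predC => /hasP[i]; rewrite mem_iota => Hi Hn.
by exists i => //; lia.
Qed.

(** Flipping an unmentioned bit of the first block changes the block but not the value; exceptional
    blocks therefore never come alone. *)
Lemma flip_unmentioned f m rest e (y : m.-tuple bool) : size (fvars f) < m ->
  exists2 y' : m.-tuple bool, y' != y & qsat e rest (val y') f = qsat e rest (val y) f.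
Proof.
move=> /unmentioned[i Hi Hf].
have Hs : size (set_nth false y i (~~ nth false y i)) == m.
  by rewrite size_set_nth size_tuple; apply/eqP/maxn_idPr.
exists (Tuple Hs).
  apply/eqP => /(congr1 (fun t : m.-tuple bool => nth false t i)) /=.
  by rewrite nth_set_nth /= eqxx; case: nth.
rewrite !qsatE; apply: qeval_ext => z _; apply: feval_fvars => j Hj.
rewrite !nth_cat size_set_nth !size_tuple (maxn_idPr Hi) nth_set_nth /=.
by case: (j =P i) => // E; rewrite -E Hj in Hf.
Qed.

(** * Correctness of the reductions *)

Lemma qsat_var0 e ms y : 0 < size y -> qsat e ms y (FVar 0) = head false y.
Proof.
move=> Hy; rewrite qsatE -[RHS](qeval_const e ms y).
by apply: qeval_ext => z _; case: y Hy.
Qed.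

Lemma qsat_not e ms y f : qsat e ms y (FNot f) = ~~ qsat (~~ e) ms y f.
Proof. by rewrite !qsatE -qeval_neg. Qed.

Lemma qsat_and0 e ms y f : 0 < size y ->
  qsat e ms y (FAnd (FVar 0) f) = head false y && qsat e ms y f.
Proof.
case: y => // -[] y _; rewrite !qsatE /=; first exact: qeval_ext.
by rewrite -[RHS](qeval_const e ms (false :: y)); apply: qeval_ext.
Qed.

Lemma qsat_or0 e ms y f : 0 < size y ->
  qsat e ms y (FOr (FVar 0) f) = head false y || qsat e ms y f.
Proof.
case: y => // -[] y _; rewrite !qsatE /=; last exact: qeval_ext.
by rewrite -[RHS](qeval_const e ms (true :: y)); apply: qeval_ext.
Qed.

Lemma qsat_true m rest f :
  qsat true (m :: rest) [::] f = [exists y : m.-tuple bool, qsat false rest (val y) f].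
Proof. by []. Qed.

Lemma qsat_false m rest f :
  qsat false (m :: rest) [::] f = [forall y : m.-tuple bool, qsat true rest (val y) f].
Proof. by []. Qed.

Lemma insert_word w D f l : ftok f l -> insert w (size D) (word D l) = word D (w ++ l).
Proof. by move=> H; rewrite /insert getdims_word /= (tokensE (ftok_norm H)). Qed.

Lemma UVAL_inv n x (P : pset -> Prop) : P Both ->
  (forall m rest f (y0 : m.-tuple bool), decode n x = Some (m :: rest, f) ->
    (forall y : m.-tuple bool, qsat false rest (val y) f = (y == y0)) -> P (Sing (head false y0))) ->
  P (UVAL n x).
Proof.
move=> PB PS; rewrite /UVAL; case E: decode => [[[|m rest] f]|] //=; case: ifP => //.
case/cards1P => y0 Sy0; case: pickP => [y|//]; rewrite Sy0 inE => /eqP ->.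
by apply: (PS m rest f y0 E) => z; move/setP/(_ z): Sy0; rewrite !inE.
Qed.

Lemma UVAL_sing n x m rest f s0 : decode n x = Some (m :: rest, f) -> size s0 = m ->
  (forall y : m.-tuple bool, qsat false rest (val y) f = (val y == s0)) ->
  UVAL n x = Sing (head false s0).
Proof.
move=> E /eqP Hs H; rewrite /UVAL E.
have -> : [set y : m.-tuple bool | qsat false rest (val y) f] = [set Tuple Hs].
  by apply/setP => y; rewrite !inE H.
rewrite cards1 eqxx; case: pickP => [y|/(_ (Tuple Hs))]; rewrite inE ?eqxx //.
by move/eqP ->.
Qed.

Lemma wf_inst_head m rest f : wf_inst (m :: rest) f -> 0 < m.
Proof. by move=> /andP[/andP[]]. Qed.

(** * From UVAL to USAT and coUSAT *)

Lemma USAT_insert n x : psub (USAT n (insert [:: tand; tleaf [::]] n x)) (UVAL n x).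
Proof.
apply: (UVAL_inv (P := fun S => psub (USAT n _) S)) => [b //|m rest f y0 E Hy].
have [D [l [<- -> HM Hl Hwf]]] := decode_sound E.
have m0 := wf_inst_head Hwf.
have Hl' : ftok (FAnd (FVar 0) f) ([:: tand; tleaf [::]] ++ l) := ftok_and (ftok_var [::]) Hl.
rewrite (insert_word _ _ Hl) /USAT (decode_word Hl') -HM; last first.
  by move: Hwf; rewrite /wf_inst /= => /andP[-> ->]; rewrite andbT ltn_addr.
have HS (y : m.-tuple bool) : qsat false rest (val y) (FAnd (FVar 0) f) = head false y0 && (y == y0).
  by rewrite qsat_and0 ?size_tuple // Hy; case: eqP => [->|_]; rewrite ?andbF.
rewrite ifT; last first.
  apply/card_le1_eqP => y y'; rewrite !inE !HS => /andP[_ /eqP ->] /andP[_ /eqP ->] //.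
suff -> : qsat true (m :: rest) [::] (FAnd (FVar 0) f) = head false y0 by [].
rewrite qsat_true; apply/existsP/idP => [[y]|Hh]; first by rewrite HS => /andP[].
by exists y0; rewrite HS Hh eqxx.
Qed.

Lemma coUSAT_insert n x : psub (coUSAT n (insert [:: tor; tleaf [::]; tnot] n x)) (UVAL n x).
Proof.
apply: (UVAL_inv (P := fun S => psub (coUSAT n _) S)) => [b //|m rest f y0 E Hy].
have [D [l [<- -> HM Hl Hwf]]] := decode_sound E.
have m0 := wf_inst_head Hwf.
have Hl' : ftok (FOr (FVar 0) (FNot f)) ([:: tor; tleaf [::]; tnot] ++ l).
  exact: ftok_or (ftok_var [::]) (ftok_not Hl).
rewrite (insert_word _ _ Hl) /coUSAT (decode_word Hl') -HM; last first.
  by move: Hwf; rewrite /wf_inst /= => /andP[-> ->]; rewrite andbT ltn_addr.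
have HS (y : m.-tuple bool) :
    ~~ qsat true rest (val y) (FOr (FVar 0) (FNot f)) = ~~ head false y0 && (y == y0).
  rewrite qsat_or0 ?size_tuple // qsat_not Hy negb_or negbK.
  by case: eqP => [->|_]; rewrite ?andbF.
rewrite ifT; last first.
  apply/card_le1_eqP => y y'; rewrite !inE !HS => /andP[_ /eqP ->] /andP[_ /eqP ->] //.
suff -> : qsat false (m :: rest) [::] (FOr (FVar 0) (FNot f)) = head false y0 by [].
rewrite qsat_false; apply/forallP/idP => [/(_ y0)|+ y]; apply: contraTT.
  by move=> Hh'; rewrite HS Hh' eqxx.
by rewrite HS => /andP[].
Qed.

(** * From USAT and coUSAT to UVAL *)

(** [Both] is not contained in a singleton, so a definite answer forces the word to decode and the
    promise to hold. *)
Lemma USAT_inv n x c : psub (USAT n x) (Sing c) -> exists m rest f,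
  [/\ decode n x = Some (m :: rest, f), qsat true (m :: rest) [::] f = c &
      forall y y' : m.-tuple bool, qsat false rest (val y) f -> qsat false rest (val y') f -> y = y'].
Proof.
have HB : ~ psub Both (Sing c) by move/(_ (~~ c) isT) => /=; case: (c).
rewrite /USAT; case E: decode => [[[|m rest] f]|] //; case: ifP => // /card_le1_eqP Hc.
move/(_ _ (eqxx _)) => /eqP Hq; exists m, rest, f; split=> // y y' Hy Hy'.
by apply: Hc; rewrite inE.
Qed.

Lemma coUSAT_inv n x c : psub (coUSAT n x) (Sing c) -> exists m rest f,
  [/\ decode n x = Some (m :: rest, f), qsat false (m :: rest) [::] f = c &
      forall y y' : m.-tuple bool, ~~ qsat true rest (val y) f -> ~~ qsat true rest (val y') f -> y = y'].
Proof.
have HB : ~ psub Both (Sing c) by move/(_ (~~ c) isT) => /=; case: (c).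
rewrite /coUSAT; case E: decode => [[[|m rest] f]|] //; case: ifP => // /card_le1_eqP Hc.
move/(_ _ (eqxx _)) => /eqP Hq; exists m, rest, f; split=> // y y' Hy Hy'.
by apply: Hc; rewrite inE.
Qed.

(** Covers the two fixed answers of [combine0]: with all dimensions 1 the first block is a single
    bit. *)
Lemma UVAL_const n f l c : 0 < n -> ftok f l -> fwf 1 f ->
  (forall ms b, qsat false ms [:: b] f = (b == c)) ->
  UVAL n (word (nseq n [:: true]) l) = Sing c.
Proof.
case: n => // n _ Hf Hwf H.
have Hw : wf_inst (map bval (nseq n.+1 [:: true])) f.
  rewrite /wf_inst map_nseq sumn_nseq /= mul1n; apply/andP; split.
    by apply/allP => i /nseqP[->].
  (* Monotonicity of [fwf] in its bound, obtained from the renaming lemma with the identity. *)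
  rewrite -(_ : fren id f = f); last by elim: (f) => //= [? ->|? -> ? ->|? -> ? ->].
  by apply: fwf_fren Hwf _ => i; lia.
have := decode_word Hf Hw; rewrite size_nseq map_nseq /= => E.
rewrite (UVAL_sing (s0 := [:: c]) E) // => -[[|b [|]] //= _].
by rewrite H eqseq_cons andbT.
Qed.

Lemma all_nseq_false u : all (fun i => ~~ nth false u i) (iota 0 (size u)) = (u == nseq (size u) false).
Proof.
rewrite (_ : all _ _ = all (pred1 false) u); last first.
  apply/allP/(all_nthP false) => [H i Hi|H i]; last by rewrite mem_iota => /H /eqP ->.
  by rewrite /= (negPf (H i _)) // mem_iota.
by apply/all_pred1P/eqP.
Qed.

Lemma all_pad (P : pred nat) off b N : b <= N ->
  all P [seq off + i | i <- [seq i <- rev (iota 0 N) | i < b]] = all (fun i => P (off + i)) (iota 0 b).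
Proof.
move=> bN; rewrite all_map; apply/allP/allP => H i.
  by rewrite mem_iota /= => Hi; apply: H; rewrite mem_filter mem_rev mem_iota; lia.
by rewrite mem_filter => /andP[Hi _]; apply: H; rewrite mem_iota.
Qed.

(** * The merged instance and its unique solution *)

Section Merge.
Variables (D E : seq (seq bool)) (d e : seq bool) (f g : form) (F G : seq token).
Hypotheses (size_DE : size D = size E) (HF : ftok f F) (HG : ftok g G).
Hypotheses (wf_f : wf_inst (map bval (d :: D)) f) (wf_g : wf_inst (map bval (e :: E)) g).
Let a := bval d.
Let b := bval e.
Let Z := zip (d :: D) (e :: E).
Let L := vals (zip D E).
Variables (N1 N2 : nat) (E1 E2 : seq (seq bool)).
Hypotheses (HE1 : map bval E1 = rev (iota 0 N1)) (HE2 : map bval E2 = rev (iota 0 N2)).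
Hypotheses (aN1 : a <= N1) (bN2 : b <= N2).

(** The first merged block reads b, z, w: the part z starts at position 1 and w at position 1 +
    a. *)
Let padW := [seq bval (badd d [:: true]) + i | i <- [seq bval i | i <- E2] & i < b].
Let padZ := [seq bval [:: true] + i | i <- [seq bval i | i <- E1] & i < a].

Definition merged : form :=
  FOr (FAnd (FVar 0) (padform padW (fren (fun i => (i + shiftA (vals Z) i).+1) f)))
      (FAnd (FNot (FVar 0)) (padform padZ (FNot (fren (fun i => (i + shiftB (vals Z) i).+1) g)))).

Lemma ftok_merged : ftok merged (merged_tokens Z d e F G E1 E2).
Proof.
have Hf := ftok_pad (badd d [:: true]) e E2 (ftok_fren (r := fun i => (i + shiftA (vals Z) i).+1) (bval_remapf Z) HF).
have Hg := ftok_pad [:: true] d E1 (ftok_not (ftok_fren (r := fun i => (i + shiftB (vals Z) i).+1) (bval_remapg Z) HG)).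
have := ftok_or (ftok_and (ftok_var [::]) Hf) (ftok_and (ftok_not (ftok_var [::])) Hg).
by rewrite /= -catA.
Qed.

Lemma unzip1_vals : unzip1 L = map bval D.
Proof.
rewrite /L /vals /unzip1 -map_comp (eq_map (g := bval \o fst)) // map_comp.
by rewrite -/(unzip1 _) unzip1_zip ?size_DE.
Qed.

Lemma unzip2_vals : unzip2 L = map bval E.
Proof.
rewrite /L /vals /unzip2 -map_comp (eq_map (g := bval \o snd)) // map_comp.
by rewrite -/(unzip2 _) unzip2_zip ?size_DE.
Qed.

Lemma bval_merged_dims : map bval (merged_dims Z) = (a + b).+1 :: sums L.
Proof.
rewrite /= !bval_badd addn1; congr (_ :: _).
by rewrite /sums /L /vals -!map_comp; apply: eq_map => -[x y] /=; rewrite bval_badd.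
Qed.

Lemma wf_merged : wf_inst (map bval (merged_dims Z)) merged.
Proof.
have /andP[/andP[a0 _] Hf] := wf_f; have /andP[_ Hg] := wf_g.
rewrite bval_merged_dims /wf_inst /=; apply/andP; split.
  rewrite /sums all_map; have : all (fun m => 0 < m) (unzip1 L) by rewrite unzip1_vals; case/andP: wf_f => /andP[].
  by rewrite all_map; apply: sub_all => p /=; exact: ltn_addr.
rewrite !fwf_padform /= /padW /padZ HE1 HE2 !all_pad //.
apply/andP; split; apply/andP; split.
- by apply/allP => i; rewrite mem_iota bval_badd /= -/a; lia.
- apply: fwf_fren Hf _ => i Hi; rewrite addSn ltnS.
  by apply: (@shiftA_lt ((a, b) :: L)); rewrite /= unzip1_vals.
- by apply/allP => i; rewrite mem_iota /=; lia.
- apply: fwf_fren Hg _ => i Hi; rewrite addSn ltnS.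
  by apply: (@shiftB_lt ((a, b) :: L)); rewrite /= unzip2_vals.
Qed.

(** With selector 1 only the first disjunct is alive, and it depends on the inner blocks through
    their f-parts alone, so [qeval_projA] applies. *)
Lemma qsat_merged_true w : size w = a + b ->
  qsat false (sums L) (true :: w) merged =
  (drop a w == nseq b false) && qsat false (map bval D) (take a w) f.
Proof.
move=> Hw; have /andP[_ Hf] := wf_f.
have Hdr : size (drop a w) = b by rewrite size_drop Hw addKn.
have Hev z : size z = sumn (sums L) -> feval merged ((true :: w) ++ z) =
    (drop a w == nseq b false) && feval f (take a w ++ projA L z).
  move=> Hz; rewrite /merged; cbn [feval]; rewrite !feval_padform [nth _ _ 0]/= /= orbF.
  congr andb.
    rewrite /padW HE2 all_pad // -[in RHS]Hdr -all_nseq_false Hdr; apply: eq_in_all => i.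
    rewrite mem_iota => /andP[_ Hi]; rewrite bval_badd -/a addnAC addn1 /=.
    by rewrite nth_cat nth_drop Hw ltn_add2l Hi.
  apply: feval_fren Hf _ => i Hi.
  have -> : take a w ++ projA L z = projA ((a, b) :: L) (w ++ z).
    rewrite /= take_cat drop_cat Hw ltnn subnn drop0.
    by case: ltnP => // ?; rewrite (_ : a - (a + b) = 0) ?take0 ?cats0 ?take_oversize //; lia.
  by rewrite /= (@nth_projA ((a, b) :: L)) //= ?unzip1_vals // size_cat Hw Hz.
rewrite !qsatE; case: eqP Hev => /= _ Hev.
  by rewrite -unzip1_vals; exact: qeval_projA.
(* If the second part of the block is not zero, the matrix is constantly false. *)
by rewrite -[RHS](qeval_const false (sums L) (true :: w)); apply: qeval_ext.
Qed.

(** With selector 0 the live matrix is the negation of g. Pulling the negation out through the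
    quantifiers turns coSAT into the negation of SAT, so the solutions are the exceptional w. *)
Lemma qsat_merged_false w : size w = a + b ->
  qsat false (sums L) (false :: w) merged =
  (take a w == nseq a false) && ~~ qsat true (map bval E) (drop a w) g.
Proof.
move=> Hw; have /andP[_ Hg] := wf_g.
have Hta : size (take a w) = a by rewrite size_takel // Hw leq_addr.
have Hev z : size z = sumn (sums L) -> feval merged ((false :: w) ++ z) =
    (take a w == nseq a false) && ~~ feval g (drop a w ++ projB L z).
  move=> Hz; rewrite /merged; cbn [feval]; rewrite !feval_padform [nth _ _ 0]/= /=.
  congr andb.
    have := all_nseq_false (take a w); rewrite Hta => <-; rewrite /padZ HE1 all_pad //; apply: eq_in_all => i.
    rewrite mem_iota => /andP[_ Hi]; rewrite (_ : bval [:: true] = 1) // add1n /= nth_cat nth_take // Hw.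
    by rewrite ltn_addr.
  congr negb; apply: feval_fren Hg _ => i Hi.
  have -> : drop a w ++ projB L z = projB ((a, b) :: L) (w ++ z).
    rewrite /= !drop_cat Hw ltnn subnn drop0.
    case: ltnP => Ha; first by rewrite take_size_cat // size_drop Hw addKn.
    have b0 : b = 0 by lia.
    by rewrite b0 take0 drop_oversize // Hw b0 addn0.
  by rewrite /= (@nth_projB ((a, b) :: L)) //= ?unzip2_vals // size_cat Hw Hz.
rewrite !qsatE -(qeval_neg false); case: eqP Hev => /= _ Hev.
  by rewrite -unzip2_vals; apply: qeval_projB.
by rewrite -[RHS](qeval_const false (sums L) (false :: w)); apply: qeval_ext.
Qed.

Lemma UVAL_merged c :
  qsat true (map bval (d :: D)) [::] f = c -> qsat false (map bval (e :: E)) [::] g = c ->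
  (forall y y' : a.-tuple bool, qsat false (map bval D) (val y) f ->
    qsat false (map bval D) (val y') f -> y = y') ->
  (forall y y' : b.-tuple bool, ~~ qsat true (map bval E) (val y) g ->
    ~~ qsat true (map bval E) (val y') g -> y = y') ->
  UVAL (size D).+1 (word (merged_dims Z) (merged_tokens Z d e F G E1 E2)) = Sing c.
Proof.
move=> Hf Hg Uf Ug; have := decode_word ftok_merged wf_merged.
rewrite bval_merged_dims (_ : size (merged_dims Z) = (size D).+1); last first.
  by rewrite /= size_map size_zip size_DE minnn.
move=> Hdec; move: Hf Hg; rewrite [map _ (d :: D)]/= [map _ (e :: E)]/= qsat_true qsat_false.
case: c => Hf Hg.
- have /existsP[x0 Hx0] := Hf.
  (* The unique solution is b = 1, z the solution of f, w = 0. Selector 0 contributes nothing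
     because g has no exceptional block when its answer is 1. *)
  rewrite (UVAL_sing (s0 := true :: val x0 ++ nseq b false) Hdec) //.
    by rewrite /= size_cat size_tuple size_nseq.
  move=> [[|h w] //= Hw]; have {}Hw : size w = a + b by move/eqP: Hw => [].
  case: h; last first.
    rewrite qsat_merged_false //; apply/negbTE; rewrite negb_and negbK; apply/orP; right.
    have Hs : size (drop a w) == b by rewrite size_drop Hw addKn.
    by have /forallP/(_ (Tuple Hs)) := Hg.
  have Hs : size (take a w) == a by rewrite size_takel // Hw leq_addr.
  rewrite qsat_merged_true // eqseq_cons /= -[in RHS](cat_take_drop a w) eqseq_cat ?size_tuple ?(eqP Hs) //.
  rewrite andbC; congr andb; apply/idP/eqP => [H|->]; last by [].
  by rewrite -[LHS]/(val (Tuple Hs)) (Uf (Tuple Hs) x0).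
- have /forallPn[x0 Hx0] := negbT Hg.
  (* Dually b = 0, z = 0 and w the exceptional block of g; selector 1 contributes nothing because f
     has no solution. *)
  rewrite (UVAL_sing (s0 := false :: nseq a false ++ val x0) Hdec) //.
    by rewrite /= size_cat size_tuple size_nseq.
  move=> [[|h w] //= Hw]; have {}Hw : size w = a + b by move/eqP: Hw => [].
  have Ht : size (take a w) == a by rewrite size_takel // Hw leq_addr.
  have Hs : size (drop a w) == b by rewrite size_drop Hw addKn.
  case: h.
    rewrite qsat_merged_true // eqseq_cons; apply/negbTE; rewrite negb_and; apply/orP; right.
    by have /existsPn/(_ (Tuple Ht)) := negbT Hf.
  rewrite qsat_merged_false // eqseq_cons /= -[in RHS](cat_take_drop a w) eqseq_cat ?size_nseq ?(eqP Ht) //.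
  congr andb; apply/idP/eqP => [H|->]; last by [].
  by rewrite -[LHS]/(val (Tuple Hs)) (Ug (Tuple Hs) x0).
Qed.

End Merge.

Lemma UVAL_combine n u v c : 0 < n -> psub (USAT n u) (Sing c) -> psub (coUSAT n v) (Sing c) ->
  UVAL n (combine n u v) = Sing c.
Proof.
move=> n0 /USAT_inv[a [ra [f [Du Hf Uf]]]] /coUSAT_inv[b [rb [g [Dv Hg Ug]]]].
have [[|d D] [F [HD -> // [Ea Era] HF wf_f]]] := decode_sound Du.
have [[|e E] [G [HE -> // [Eb Erb] HG wf_g]]] := decode_sound Dv.
subst a ra b rb.
have Gu : getdims n (chunk (word (d :: D) F)) = (d :: D, emittoks F) by rewrite -HD getdims_word.
have Gv : getdims n (chunk (word (e :: E) G)) = (e :: E, emittoks G) by rewrite -HE getdims_word.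
rewrite /combine Gu Gv /combine0 [_.1]/= [_.2]/= [head _ _]/= [head _ (e :: E)]/=.
rewrite !bltE !enumb1; case: ltnP => HNa.
  have Hc : c = false.
    apply/negbTE/negP => Hc; move: Hf; rewrite Hc qsat_true => /existsP[y Hy].
    have [|y' Ny Hy'] := flip_unmentioned (map bval D) false y (f := f).
      (* Variables mentioned are at most as many as tokens, and tokens at most as many as bit pairs,
         which is the length tested by [combine0]. *)
      by apply: leq_ltn_trans HNa; apply: leq_trans (size_fvars HF) (size_emittoks F).
    by case/eqP: Ny; apply: Uf; rewrite // Hy'.
  rewrite Hc; apply: (UVAL_const n0 (ftok_not (ftok_var [::]))) => // ms y.
  by rewrite qsat_not qsat_var0 //; case: y.
case: ltnP => HNb.
  have Hc : c = true.
    (* Were the answer 0, there would be an exceptional block, and flipping an unmentioned bit would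
       give a second one. *)
    apply/negPn/negP => Hc; move: Hg; rewrite (negPf Hc) qsat_false => /negbT/forallPn[y Hy].
    have [|y' Ny Hy'] := flip_unmentioned (map bval E) true y (f := g).
      by apply: leq_ltn_trans HNb; apply: leq_trans (size_fvars HG) (size_emittoks G).
    by case/eqP: Ny; apply: Ug; rewrite // Hy'.
  rewrite Hc; apply: (UVAL_const n0 (ftok_var [::])) => // ms y.
  by rewrite qsat_var0 //; case: y.
have size_DE : size D = size E by move: HD HE => /= <- [].
rewrite (tokensE (ftok_norm HF)) (tokensE (ftok_norm HG)).
have -> : zipn n (d :: D) (e :: E) = zip (d :: D) (e :: E) by rewrite -HD zipnE //= size_DE.
rewrite -HD.
exact: (UVAL_merged size_DE HF HG wf_f wf_g (enumb2 _) (enumb2 _) HNa HNb Hf Hg Uf Ug).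
Qed.

Lemma psub_trans S T U : psub S T -> psub T U -> psub S U.
Proof. by move=> H H' c /H /H'. Qed.

(* [UVAL_n] = [USAT_n] \cap [coUSAT_n], as classes of promise problems *)
Theorem theorem10 (n : nat) (hn : 1 <= n) :
  forall phi : promise,
    reducible phi (UVAL n) <-> reducible phi (USAT n) /\ reducible phi (coUSAT n).
Proof.
move=> phi; split=> [[mu [Pmu Hmu]]|[[mu1 [P1 H1]] [mu2 [P2 H2]]]].
  (* The given machine is turned into a program, composed with the token edit, and compiled
     again. *)
  have HP w : polytime (fun x => insert w n (mu x)).
    by apply: polytime_of_fp; exact: (fp_comp (fp_of_polytime Pmu) (fp_insert w n)).
  split.
    exists (fun x => insert [:: tand; tleaf [::]] n (mu x)); split=> // x /Hmu[_ Hx].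
    by split; [exact: word_neq0|exact: (psub_trans (@USAT_insert n (mu x)) Hx)].
  exists (fun x => insert [:: tor; tleaf [::]; tnot] n (mu x)); split=> // x /Hmu[_ Hx].
  by split; [exact: word_neq0|exact: (psub_trans (@coUSAT_insert n (mu x)) Hx)].
exists (fun x => combine n (mu1 x) (mu2 x)); split.
  by apply: polytime_of_fp; apply: fp_combine; exact: fp_of_polytime.
move=> x Nx; split; first exact: combine_neq0.
have [_ S1] := H1 x Nx; have [_ S2] := H2 x Nx.
(* If [phi x] is [Both], nothing is required; otherwise both instances are forced to the same
   definite answer c. *)
case: (phi x) S1 S2 => [c|] S1 S2; last by [].
by rewrite (UVAL_combine hn S1 S2).
Qed.
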